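(* Let $n\ge 2$ be an integer and $\lambda\in\mathbb{R}$. Consider the autonomous ODE system for $(W,X,Y)(y)$, $'=\frac{d}{dy}$, $$W'=W(X^2-\lambda W^2),\qquad X'=X^3-X+\tfrac{Y^2}{\sqrt n}+\lambda(\sqrt n-X)W^2,\qquad Y'=Y\big(X^2-\tfrac{X}{\sqrt n}-\lambda W^2\big).$$ For all initial conditions $(W(0),X(0),Y(0))$ with $Y(0)>0$, $W(0)>0$ that are sufficiently close to the equilibrium point $(0,1,0)$, the unique solution of the system exists for all $y\in(-\infty,0]$ and corresponds (via the correspondence described in the context) to a metric $g=dx^2+\psi^2(x)g_{\mathbb{S}^n}$ which, together with the associated potential function $\phi=\phi(x)$, $\omega=\dot\phi$, solves the gradient Ricci soliton equation $$\mathrm{Ric}(g)+\nabla\nabla\phi+\lambda g=0,$$ and which has the asymptotic profile $$\psi(x)\sim a\,x^{\frac{1}{\sqrt n}}\ \text{ for some } a>0,\qquad \omega(x)\sim\frac{\sqrt n-1}{x},\qquad\text{as }x\to0^+ .$$ These metrics are defined for $x\in(0,\delta)$, for some small $\delta>0$, and $\psi,\omega$ have a smooth limit as $x\to\delta^-$.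
   Context: $g_{\mathbb{S}^n}$ is the canonical metric of the unit $n$-sphere; metrics are on $(0,\delta)\times\mathbb{S}^n$; $\psi>0$ is smooth, and the potential $\phi$ depends only on $x$; $\dot{}=\frac{d}{dx}$. For such metrics, with $\omega=\dot\phi$, the gradient Ricci soliton equation is equivalent to the system $n\ddot\psi-\psi\dot\omega=\lambda\psi$, $\ \psi\ddot\psi+(n-1)\dot\psi^2-(n-1)-\psi\dot\psi\omega=\lambda\psi^2$. Correspondence: $W=\frac{1}{-\omega+n\dot\psi/\psi}$, $X=\sqrt n\,W\frac{\dot\psi}{\psi}$, $Y=\frac{\sqrt{n(n-1)}\,W}{\psi}$, with independent variable $y$ given by $dy=\frac{dx}{W}$, normalized so that $x\to0^+$ as $y\to-\infty$. Conversely, from $(W,X,Y)(y)$ one recovers $x(y)=\int_{-\infty}^yW\,dy$, $\psi=\sqrt{n(n-1)}\,\frac{W}{Y}$, $\omega=n\frac{\dot\psi}{\psi}-\frac1W=\frac{\sqrt n X-1}{W}$. The symbol $\sim$ means that the ratio of the two sides tends to $1$. *)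

(* Defs.v *)
From HB Require Import structures.
From mathcomp Require Import all_boot all_order all_algebra.
From mathcomp Require Import all_classical all_reals all_analysis.
Set Implicit Arguments.
Unset Strict Implicit.
Unset Printing Implicit Defensive.
Import Order.TTheory GRing.Theory Num.Theory.
Import numFieldNormedType.Exports.
Local Open Scope ring_scope.
Local Open Scope classical_set_scope.

Section LocalCoordinates.
Context {R : realType} {m : nat}.
Implicit Types (f phi : 'rV[R]_m -> R) (g : 'rV[R]_m -> 'M[R]_m).

Definition partial (i : 'I_m) f (p : 'rV[R]_m) : R := 'D_(delta_mx 0 i) f p.

(* Index order: [christoffel g k i j] is Gamma^k_ij. *)
Definition christoffel g (k i j : 'I_m) (p : 'rV[R]_m) : R :=
  2^-1 * \sum_(l < m) invmx (g p) k l *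
    (partial i (fun q => g q j l) p + partial j (fun q => g q i l) p
     - partial l (fun q => g q i j) p).

(* Contraction R^k_ikj of the curvature tensor; with this sign the unit
   n-sphere has Ric = (n - 1) g. *)
Definition ricci g (p : 'rV[R]_m) : 'M[R]_m :=
  \matrix_(i, j)
    (\sum_(k < m) (partial k (christoffel g k i j) p
                   - partial j (christoffel g k i k) p)
     + \sum_(k < m) \sum_(l < m)
         (christoffel g k k l p * christoffel g l i j p
          - christoffel g k j l p * christoffel g l i k p)).

Definition hessian g phi (p : 'rV[R]_m) : 'M[R]_m :=
  \matrix_(i, j) (partial i (partial j phi) p
                  - \sum_(k < m) christoffel g k i j p * partial k phi p).

Definition gradient_soliton_at g phi (lambda : R) (p : 'rV[R]_m) : Prop :=
  ricci g p + hessian g phi p + lambda *: g p = 0.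

End LocalCoordinates.

Section WarpedProduct.
Context {R : realType} {n : nat}.

(* Inverse stereographic projection R^n -> S^n in R^(n+1), from the north pole
   ([s = false]) or the south pole ([s = true]); the images of the two maps
   cover S^n.  The norm of the library on row vectors is the sup norm, hence
   the explicit Euclidean one. *)
Definition stereographic (s : bool) (u : 'rV[R]_n) : 'rV[R]_(n + 1) :=
  let r2 := \sum_(i < n) u 0 i ^+ 2 in
  row_mx ((2 / (1 + r2)) *: u) (((-1) ^+ s * ((r2 - 1) / (r2 + 1)))%:M).

(* The metric induced on S^n by the Euclidean metric of R^(n+1), read in a
   stereographic chart. *)
Definition sphere_metric (s : bool) (u : 'rV[R]_n) : 'M[R]_n :=
  \matrix_(i, j) \sum_(k < n + 1)
    partial i (fun v => stereographic s v 0 k) u *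
    partial j (fun v => stereographic s v 0 k) u.

(* Coordinates on (0, delta) x S^n: a point [p] is the row (x, u). *)
Definition xcoord (p : 'rV[R]_(1 + n)) : R := lsubmx p 0 0.

Definition warped_metric (psi : R -> R) (s : bool) (p : 'rV[R]_(1 + n)) :
    'M[R]_(1 + n) :=
  block_mx 1%:M 0 0 (psi (xcoord p) ^+ 2 *: sphere_metric s (rsubmx p)).

(* The tensor equation on (0, delta) x S^n, checked in both charts of S^n. *)
Definition warped_gradient_soliton (lambda delta : R) (psi phi : R -> R) : Prop :=
  forall (s : bool) (p : 'rV[R]_(1 + n)), 0 < xcoord p < delta ->
    gradient_soliton_at (warped_metric psi s) (phi \o xcoord) lambda p.

End WarpedProduct.

Arguments warped_gradient_soliton {R} n lambda delta psi phi.

Section System.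
Context {R : realType}.
Implicit Types (W X Y psi omega : R -> R).

(* Derivative relative to [J]: one-sided at an end point of an interval. *)
Definition derivative_within (J : set R) (f : R -> R) (y l : R) : Prop :=
  (f z - f y) / (z - y) @[z --> within J y^'] --> l.

Definition soliton_system (n : nat) (lambda : R) (J : set R) W X Y : Prop :=
  forall y : R, J y ->
  [/\ derivative_within J W y (W y * (X y ^+ 2 - lambda * W y ^+ 2)),
      derivative_within J X y
        (X y ^+ 3 - X y + Y y ^+ 2 / Num.sqrt n%:R
         + lambda * (Num.sqrt n%:R - X y) * W y ^+ 2) &
      derivative_within J Y y
        (Y y * (X y ^+ 2 - X y / Num.sqrt n%:R - lambda * W y ^+ 2))].

Definition arclength W (y : R) : R :=
  \int[lebesgue_measure]_(z in `]-oo, y]) W z.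

(* [W, X, Y] on (-oo, 0] and [psi, omega] on (0, delta) correspond to each
   other, in both directions, through [x = arclength W y]. *)
Record corresponds (n : nat) (delta : R) W X Y psi omega : Prop := Corresponds {
  corr_integrable :
    lebesgue_measure.-integrable `]-oo, 0%R] (EFin \o W) ;
  corr_xN : arclength W y @[y --> -oo] --> 0^'+ ;
  corr_x0 : arclength W 0 = delta ;
  corr_image : arclength W @` `]-oo, 0[ = `]0, delta[ ;
  corr_from : forall y : R, y < 0 -> let x := arclength W y in
    psi x = Num.sqrt (n%:R * (n%:R - 1)) * (W y / Y y) /\
    omega x = (Num.sqrt n%:R * X y - 1) / W y ;
  corr_to : forall y : R, y < 0 -> let x := arclength W y in
    [/\ W y = (- omega x + n%:R * ((psi^`())%classic x / psi x))^-1,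
        X y = Num.sqrt n%:R * W y * ((psi^`())%classic x / psi x) &
        Y y = Num.sqrt (n%:R * (n%:R - 1)) * W y / psi x] }.

Definition smooth_on (a b : R) (f : R -> R) : Prop :=
  forall (k : nat) (x : R), a < x < b -> derivable (f^`(k)) x 1.

Definition smooth_left_limit (f : R -> R) (b : R) : Prop :=
  forall k : nat, cvg (f^`(k) x @[x --> b^'-]).

Definition equivalent_at_0plus (f h : R -> R) : Prop :=
  f x / h x @[x --> 0^'+] --> (1 : R).

End System.

(* Main.v *)
Require Import Defs.
From HB Require Import structures.
From mathcomp Require Import all_boot all_order all_algebra.
From mathcomp Require Import all_classical all_reals all_analysis.
From mathcomp Require Import ring lra.
Import Order.TTheory GRing.Theory Num.Theory.
Import numFieldNormedType.Exports.
Local Open Scope ring_scope.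
Local Open Scope classical_set_scope.

Set Implicit Arguments.
Unset Strict Implicit.
Unset Printing Implicit Defensive.

(** The point (0, 1, 0) is a source of the system: the linear part there is
    diagonal, with eigenvalues 1, 2 and b = 1 - 1 / sqrt n, all positive when
    n >= 2.  Everything follows from this.

    With u = (W, X - 1, Y) the right-hand side is D u + N(u), D linear and N of
    second order.  Replacing N(u) by N(clamp u), where clamp truncates each
    coordinate to a small interval, gives a globally Lipschitz field, whose
    solutions exist for all times by Picard iteration ([lipschitz_ode_exists]).
    The energy V = |u|^2 satisfies V' >= b V for the truncated field at every
    point, not only near the source ([nonlin_small], [energy_growth]), so that
    V decays like exp(b y) as y decreases; a solution that starts in the small
    box therefore never leaves it backwards in time, where truncation does
    nothing, and solves the original system ([soliton_flow]).  Uniqueness is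
    Gronwall's inequality ([soliton_unique]).

    The exponential decay makes W integrable at minus infinity, so x = S(y),
    the primitive of W that vanishes there, is an increasing bijection from the
    negative half-line onto ]0, delta[ ([primitive_inverse]).  In the variable
    x, every polynomial in W, X, Y, 1/W, 1/Y has a derivative of the same kind,
    because d/dx = (1/W) d/dy.  This gives smoothness on ]0, delta[ and finite
    limits of all derivatives at delta, where y = 0 and the polynomials are
    continuous.

    For the asymptotics, W' = W (1 + O(exp(b y / 2))) while S' = W, which forces
    W / S -> 1 ([W_equiv_S]); and the logarithm of (W / Y) / W^(1 / sqrt n) has
    an exponentially small derivative, hence a limit ([WY_equiv_power]).

    Finally the metric dx^2 + psi^2 g_S is, in a stereographic chart, the
    diagonal metric dx^2 + (psi c)^2 |du|^2 with conformal factor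
    c = 2 / (1 + |u|^2) ([sphere_metricE]).  Its Christoffel symbols have the
    single formula [warped_gamma] for all triples of indices, and contracting
    that formula turns the tensor equation into the two scalar equations for
    psi and omega ([warped_soliton]), which the system in (W, X, Y)
    implies. *)

(** * Primitives and comparison of functions through their derivatives *)

Section Calculus.
Context {R : realType}.
Implicit Types (f g F : R -> R) (a b x : R).

Lemma is_derive_continuous f x l : is_derive x (1 : R) f l -> {for x, continuous f}.
Proof.
by move=> [df _]; apply/differentiable_continuous/derivable1_diffP.
Qed.

Lemma is_derive_within_continuous f f' a b :
  (forall s, a <= s <= b -> is_derive s (1 : R) f (f' s)) ->
  {within `[a, b], continuous f}.
Proof.
move=> df; apply: continuous_in_subspaceT => z; rewrite inE/= in_itv/= => zab.
exact: is_derive_continuous (df z zab).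
Qed.

Lemma ge0_derive_homo f f' a b : a <= b ->
  (forall s, a <= s <= b -> is_derive s (1 : R) f (f' s)) ->
  (forall s, a <= s <= b -> 0 <= f' s) -> f a <= f b.
Proof.
move=> ab df f'0.
have [||c cab E] := @MVT_segment _ f f' a b ab.
- by move=> x; rewrite in_itv/= => /andP[ax xb]; apply: df; rewrite !ltW.
- exact: is_derive_within_continuous df.
- rewrite -subr_ge0 E mulr_ge0 ?subr_ge0 //; apply: f'0.
  by move: cab; rewrite in_itv.
Qed.

(** A mean value inequality that avoids integrals: both g + f and g - f are
    nondecreasing. *)
Lemma derive_dominated f f' g g' a b : a <= b ->
  (forall s, a <= s <= b -> is_derive s (1 : R) f (f' s)) ->
  (forall s, a <= s <= b -> is_derive s (1 : R) g (g' s)) ->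
  (forall s, a <= s <= b -> `|f' s| <= g' s) -> `|f b - f a| <= g b - g a.
Proof.
move=> ab df dg fg.
have dD s : a <= s <= b -> is_derive s (1 : R) (g \+ f) ((g' \+ f') s).
  by move=> sab; apply: is_deriveD; [exact: dg|exact: df].
have dB s : a <= s <= b -> is_derive s (1 : R) (g \- f) ((g' \- f') s).
  by move=> sab; apply: is_deriveB; [exact: dg|exact: df].
have fN s : a <= s <= b -> 0 <= (g' \+ f') s.
  by move=> sab; have := fg s sab; rewrite ler_norml => /andP[] /=; lra.
have fP s : a <= s <= b -> 0 <= (g' \- f') s.
  by move=> sab; have := fg s sab; rewrite ler_norml => /andP[] /=; lra.
have /= := ge0_derive_homo ab dD fN; have /= := ge0_derive_homo ab dB fP.
by rewrite ler_norml => H1 H2; apply/andP; split; lra.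
Qed.

Lemma derive0_eq f a b : a <= b ->
  (forall s, a <= s <= b -> is_derive s (1 : R) f 0) -> f a = f b.
Proof.
move=> ab df; apply/eqP; rewrite eq_sym -subr_eq0 -normr_le0.
have := @derive_dominated f (cst 0) (cst 0) (cst 0) a b ab df.
by rewrite /= subrr; apply => s sab; rewrite normr0.
Qed.

(** The fundamental theorem of calculus gives derivatives only to the right of
    the base point of the integral; basing it at -1 covers 0 and all positive
    times. *)
Lemma primitive_half f : continuous f ->
  exists F, F 0 = 0 /\ forall x, -1 < x -> is_derive x (1 : R) F (f x).
Proof.
move=> cf.
pose A (x : R) := (\int[@lebesgue_measure R]_(t in `[-1, x]) f t)%R.
exists (A \- cst (A 0)); split; first by rewrite /= subrr.
move=> x x1.
have [dA A'] : derivable A x 1 /\ A^`() x = f x.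
  apply: (@continuous_FTC1_closed _ f (-1) x (x + 1)) => //.
  - by rewrite ltrDl.
  - apply: continuous_compact_integrable; first exact: segment_compact.
    exact: continuous_subspaceT.
  - exact: cf.
rewrite derive1E in A'; have iA := DeriveDef dA A'.
by rewrite -[f x]subr0; apply: is_deriveB.
Qed.

(** Two one-sided primitives, of f and of its reflection, agree on ]-1, 1[ and
    can be glued at 0. *)
Lemma primitive_exists f : continuous f ->
  exists F, F 0 = 0 /\ forall x, is_derive x (1 : R) F (f x).
Proof.
move=> cf; have [A [A0 dA]] := primitive_half cf.
have cfN : continuous (f \o -%R).
  by move=> x; apply: continuous_comp; [exact: opp_continuous|exact: cf].
have [B [B0 dB]] := primitive_half cfN.
(* C covers ]-oo, 1[ as A covers ]-1, +oo[. *)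
pose C x := - B (- x).
have dC x : x < 1 -> is_derive x (1 : R) C (f x).
  move=> x1; have := dB (- x); rewrite ltrN2 => /(_ x1) dBx.
  have -> : f x = - ((f \o -%R) (- x) * (- 1)) by rewrite /= opprK mulrN1 opprK.
  exact: is_deriveN.
have AC x : -1 < x < 1 -> A x = C x.
  move=> /andP[x1 x2]; apply/eqP; rewrite -subr_eq0; apply/eqP.
  have E0 : A 0 - C 0 = 0 by rewrite /C oppr0 B0 oppr0 A0 subrr.
  have dAC (s : R) : -1 < s < 1 -> is_derive s (1 : R) (A \- C) 0.
    move=> /andP[s1 s2]; rewrite -(subrr (f s)).
    by apply: is_deriveB; [exact: dA|exact: dC].
  have [x0|x0] := leP 0 x.
    rewrite -E0; apply/esym/(@derive0_eq (A \- C) 0 x x0) => s /andP[s0 sx].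
    by apply: dAC; apply/andP; split; lra.
  rewrite -E0; apply/(@derive0_eq (A \- C) x 0 (ltW x0)) => s /andP[s0 sx].
  by apply: dAC; apply/andP; split; lra.
exists (fun x => if x < 0 then C x else A x); split; first by rewrite ltxx.
move=> x; have [x0|x0] := ltP x 0.
  apply: near_eq_is_derive (dC x _); last by lra.
  by near=> z; rewrite ifT //; near: z; exact: lt_nbhsl.
apply: near_eq_is_derive (dA x _); last by lra.
near=> z; case: ifP => // z0; apply: AC; rewrite (lt_trans z0) // andbT.
by near: z; apply: lt_nbhsr; lra.
Unshelve. all: by end_near. Qed.

End Calculus.

(** * Picard iteration on the whole line *)

Section Exponential.
Context {R : realType}.
Implicit Types (f g F : R -> R) (a b x : R).

Lemma is_derive_expRM K x :
  is_derive x (1 : R) (fun s => expR (K * s)) (K * expR (K * x)).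
Proof.
have d1 : is_derive x (1 : R) (fun s : R => K * s) K.
  have -> : (fun s : R => K * s) = K \*: id by [].
  by apply: is_derive_eq; rewrite /GRing.scale /= mulr1.
rewrite mulrC; exact: (@is_derive1_comp _ expR (fun s => K * s)).
Qed.

(** The weights exp(K |t|) are the ones for which integration gains a factor
    1 / K on both sides of 0; this makes Picard iteration contract on the whole
    line at once. *)
Lemma derive_exp_dominated f f' K B : 0 < K -> f 0 = 0 ->
  (forall s, is_derive s (1 : R) f (f' s)) ->
  (forall s, `|f' s| <= B * expR (K * `|s|)) ->
  forall t, `|f t| <= B / K * expR (K * `|t|).
Proof.
move=> K0 f0 df fB.
have B0 : 0 <= B.
  have := le_trans (normr_ge0 _) (fB 0).
  by rewrite normr0 mulr0 expR0 mulr1.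
have half (h h' : R -> R) : h 0 = 0 -> (forall s, is_derive s (1 : R) h (h' s)) ->
    (forall s, `|h' s| <= B * expR (K * `|s|)) ->
    forall t, 0 <= t -> `|h t| <= B / K * expR (K * t).
  move=> h0 dh hB t t0.
  pose g s := B / K * expR (K * s).
  have dg s : is_derive s (1 : R) g (B * expR (K * s)).
    have -> : B * expR (K * s) = (B / K) *: (K * expR (K * s)).
      by rewrite /GRing.scale /= mulrA divfK // gt_eqF.
    have -> : g = (B / K) \*: (fun s => expR (K * s)) by [].
    by apply: is_deriveZ; exact: is_derive_expRM.
  have := @derive_dominated _ h h' g (fun s => B * expR (K * s)) 0 t t0.
  rewrite h0 subr0 => /(_ (fun s _ => dh s) (fun s _ => dg s)) H.
  apply: le_trans (H _) _.
    by move=> s /andP[s0 _]; have := hB s; rewrite (ger0_norm s0).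
  by rewrite lerBlDr lerDl mulr_ge0 ?expR_ge0 // divr_ge0 // ltW.
move=> t; have [t0|t0] := leP 0 t.
  by rewrite (ger0_norm t0); apply: half df _ _ _.
rewrite (ltr0_norm t0).
have := half (fun s => f (- s)) (fun s => - f' (- s)) _ _ _ (- t).
rewrite opprK oppr0 f0; apply => //; last by lra.
- move=> s; rewrite -mulrN1.
  exact: (@is_derive1_comp _ f -%R).
- by move=> s; rewrite normrN -[`|s|]normrN.
Qed.

(** The intervals of radius 2 B / 2^k around v k are nested, and the limit is
    their common point. *)
Lemma geometric_limit (v : nat -> R) (B : R) :
  (forall k, `|v k.+1 - v k| <= B * 2^-1 ^+ k) ->
  exists l, forall k, `|v k - l| <= B *+ 2 * 2^-1 ^+ k.
Proof.
move=> vB.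
pose d k : R := B *+ 2 * 2^-1 ^+ k.
have dS k : d k.+1 = d k - B * 2^-1 ^+ k.
  by rewrite /d exprS mulrA -[in B *+ 2 * 2^-1]mulr_natr; field.
have d0 k : 0 <= d k.
  rewrite /d; apply: mulr_ge0; last by rewrite exprn_ge0.
  rewrite mulrn_wge0 //; have := le_trans (normr_ge0 _) (vB 0%N).
  by rewrite expr0 mulr1.
have lo k m : v k - d k <= v (k + m)%N - d (k + m)%N.
  elim: m => [|m IH]; rewrite ?addn0 // addnS dS (le_trans IH) //.
  by have := vB (k + m)%N; rewrite ler_norml => /andP[]; lra.
have up k m : v (k + m)%N + d (k + m)%N <= v k + d k.
  elim: m => [|m IH]; rewrite ?addn0 // addnS dS (le_trans _ IH) //.
  by have := vB (k + m)%N; rewrite ler_norml => /andP[]; lra.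
have lu k m : v k - d k <= v m + d m.
  by have := lo k m; have := up m k; rewrite (addnC m k); have := d0 (k + m)%N; lra.
pose S := range (fun k => v k - d k).
have Su m : ubound S (v m + d m) by move=> _ [k _ <-].
have Ss : has_sup S by split; [exists (v 0%N - d 0%N), 0%N | exists (v 0%N + d 0%N)].
exists (sup S) => k; rewrite -/(d k) ler_distl; apply/andP; split.
  by rewrite lerBlDr ge_sup //; case: Ss.
by rewrite -lerBlDr; apply: (sup_upper_bound Ss); exists k.
Qed.

Lemma continuous_locally_approx f t :
  (forall e, 0 < e -> exists g, {for t, continuous g} /\
     forall s, `|s - t| <= 1 -> `|f s - g s| <= e) ->
  {for t, continuous f}.
Proof.
move=> H; apply/cvgrPdist_le => e e0.
have e3 : 0 < e / 3 by rewrite divr_gt0.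
have [g [cg fg]] := H _ e3.
near=> s.
have st : `|s - t| <= 1.
  rewrite distrC; near: s; exact: (@cvgr_dist_le _ _ _ _ _ id t (@cvg_id _ _) 1).
have gst : `|g t - g s| <= e / 3.
  by near: s; move/cvgrPdist_le : cg; apply.
have := fg s st; have := fg t; rewrite subrr normr0 => /(_ ler01).
move: gst; rewrite !ler_norml => /andP[? ?] /andP[? ?] /andP[? ?].
by apply/andP; split; lra.
Unshelve. all: by end_near. Qed.

End Exponential.

Section Picard.
Context {R : realType} {I : finType}.
Variables (G : (I -> R) -> I -> R) (L : R).
Hypothesis L0 : 0 <= L.
Hypothesis GL : forall a b i, `|G a i - G b i| <= L * \sum_j `|a j - b j|.

Lemma lipschitz_comp_continuous (u : I -> R -> R) (i : I) (t : R) :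
  (forall j, {for t, continuous (u j)}) ->
  {for t, continuous (fun s => G (fun j => u j s) i)}.
Proof.
move=> cu; apply/cvgrPdist_le => e e0.
have N0 : 0 < L * #|I|%:R + 1 by rewrite ltr_wpDl // mulr_ge0.
have d0 : 0 < e / (L * #|I|%:R + 1) by rewrite divr_gt0.
(* Room for #|I| coordinates; the extra 1 avoids dividing by zero. *)
have near_u : \forall s \near t, forall j, `|u j t - u j s| <= e / (L * #|I|%:R + 1).
  by apply: (@filter_forall _ I _ (nbhs t) _) => j; have /cvgrPdist_le := cu j; apply.
near=> s; apply: le_trans (GL _ _ _) _.
have us : forall j, `|u j t - u j s| <= e / (L * #|I|%:R + 1) by near: s.
apply: (@le_trans _ _ (L * \sum_(j : I) (e / (L * #|I|%:R + 1)))).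
  by rewrite ler_wpM2l // ler_sum.
rewrite sumr_const -[_ *+ _]mulr_natr; set d := e / _.
have dE : d * (L * #|I|%:R + 1) = e by rewrite divfK // gt_eqF.
have -> : L * (d * #|I|%:R) = d * (L * #|I|%:R + 1) - d by ring.
by rewrite dE; have := ltW d0; rewrite -/d; lra.
Unshelve. all: by end_near. Qed.

Let K := 2 * (L * #|I|%:R + 1).

Let half_add_half (m E q : R) :
  (m * E) *+ 2 * (2^-1 * q) + (m *+ 2 * q) / 2 * E = (m * E) *+ 2 * q.
Proof. by field. Qed.

Let K_gt0 : 0 < K.
Proof. by rewrite mulr_gt0 // ltr_wpDl // mulr_ge0. Qed.

(** K is twice the Lipschitz constant of G for the sup norm, plus a margin that
    keeps it positive, so one integration halves the weighted
    distance. *)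
Lemma picard_contraction (v w : I -> R -> R) (B : R) (i : I) (f g : R -> R) :
  0 <= B ->
  (forall j s, `|v j s - w j s| <= B * expR (K * `|s|)) ->
  f 0 = g 0 ->
  (forall s, is_derive s (1 : R) f (G (fun j => v j s) i)) ->
  (forall s, is_derive s (1 : R) g (G (fun j => w j s) i)) ->
  forall s, `|f s - g s| <= B / 2 * expR (K * `|s|).
Proof.
move=> B0 vw fg0 df dg s.
have := @derive_exp_dominated _ (f \- g)
  (fun s => G (fun j => v j s) i - G (fun j => w j s) i) K (B * (L * #|I|%:R)) K_gt0.
rewrite /= fg0 subrr => /(_ erefl (fun s => is_deriveB (df s) (dg s))) H.
apply: le_trans (H _ s) _ => [r|].
  apply: le_trans (GL _ _ _) _.
  apply: (@le_trans _ _ (L * \sum_(j : I) (B * expR (K * `|r|)))).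
    by rewrite ler_wpM2l // ler_sum.
  by rewrite sumr_const -mulr_natr le_eqVlt; apply/orP; left; apply/eqP; ring.
rewrite ler_wpM2r ?expR_ge0 // -mulrA ler_wpM2l // ler_pdivrMr // /K.
by rewrite mulrA mulVf ?pnatr_eq0 // mul1r lerDl.
Qed.

(** Picard iteration.  The limit of the iterates is identified as a fixed point
    by the contraction estimate, without passing to the limit under an
    integral sign. *)
Lemma lipschitz_ode_exists (u0 : I -> R) : exists u : I -> R -> R,
  (forall i, u i 0 = u0 i) /\
  forall i t, is_derive t (1 : R) (u i) (G (fun j => u j t) i).
Proof.
have /choice[P HP] : forall f : R -> R, exists F : R -> R, continuous f ->
    F 0 = 0 /\ forall x, is_derive x (1 : R) F (f x).
  move=> f; have [cf|ncf] := pselect (continuous f); last by exists f.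
  by have [F HF] := primitive_exists cf; exists F.
pose step (v : I -> R -> R) i t := u0 i + P (fun s => G (fun j => v j s) i) t.
pose u k := iter k step (fun i => cst (u0 i)).
have step0 v i : (forall j, continuous (v j)) -> step v i 0 = u0 i.
  move=> cv; rewrite /step (HP _ _).1 ?addr0 // => t.
  by apply: lipschitz_comp_continuous => j; exact: cv.
have step' v i t : (forall j, continuous (v j)) ->
    is_derive t (1 : R) (step v i) (G (fun j => v j t) i).
  move=> cv; rewrite -[G _ _]add0r; apply: is_deriveD.
  apply: (HP _ _).2 => s.
  by apply: lipschitz_comp_continuous => j; exact: cv.
have cu k : forall j, continuous (u k j).
  elim: k => [|k IH] j t; first exact: cst_continuous.
  by apply: is_derive_continuous; apply: step'.
have u00 k i : u k i 0 = u0 i by case: k => [//|k]; apply: step0.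
(* M bounds the weighted distance between the first two iterates. *)
have [M [M0 HM]] : exists M, 0 <= M /\
    forall i t, `|u 1%N i t - u 0%N i t| <= M * expR (K * `|t|).
  exists ((\sum_j `|G u0 j|) / K); split.
    by rewrite divr_ge0 ?sumr_ge0 // ltW.
  move=> i t; apply: (@derive_exp_dominated _ (u 1%N i \- u 0%N i) (fun=> G u0 i)) => //.
  - by rewrite -[LHS]/(u 1%N i 0 - u 0%N i 0) !u00 subrr.
  - by move=> s; rewrite -[G _ _]subr0; apply: is_deriveB; exact: (step' _ i s (cu 0%N)).
  - move=> s; rewrite -[leLHS]mulr1; apply: ler_pM => //.
      by rewrite (bigD1 i) //= lerDl sumr_ge0.
    by rewrite -expR0 ler_expR mulr_ge0 // ltW.
have uS k i t : `|u k.+1 i t - u k i t| <= (M * expR (K * `|t|)) * 2^-1 ^+ k.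
  rewrite mulrAC; elim: k i t => [|k IH] i t; first by rewrite expr0 mulr1.
  rewrite exprSr mulrA; apply: (@picard_contraction (u k.+1) (u k) _ i) => //.
  - by rewrite mulr_ge0 // exprn_ge0.
  - by rewrite !u00.
  - by move=> s; exact: (step' (u k.+1) i s (cu k.+1)).
  - by move=> s; exact: (step' (u k) i s (cu k)).
have /choice[v Hv] : forall i, exists v : R -> R, forall t k,
    `|u k i t - v t| <= (M * expR (K * `|t|)) *+ 2 * 2^-1 ^+ k.
  move=> i; suff /choice[v Hv] : forall t, exists l, forall k,
    `|u k i t - l| <= (M * expR (K * `|t|)) *+ 2 * 2^-1 ^+ k by exists v.
  by move=> t; apply: geometric_limit.
have half0 (B : R) e : 0 <= B -> 0 < e -> exists k, B * 2^-1 ^+ k <= e.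
  move=> B0 e0.
  have /cvgrPdist_le/(_ e e0)[k _ /(_ k (leqnn k))] : B * 2^-1 ^+ k @[k --> \oo] --> 0.
    by rewrite -(mulr0 B); apply: cvgMr; apply: cvg_expr; rewrite ger0_norm; lra.
  rewrite /= sub0r normrN ger0_norm; last by rewrite mulr_ge0 // exprn_ge0.
  by move=> H; exists k.
have B0 (x : R) : 0 <= (M * expR x) *+ 2 by rewrite mulrn_wge0 // mulr_ge0 // expR_ge0.
have cv i : continuous (v i).
  move=> t; apply: continuous_locally_approx => e e0.
  have [k Hk] := half0 ((M * expR (K * (`|t| + 1))) *+ 2) e (B0 _) e0.
  exists (u k i); split; first exact: cu.
  move=> s st; rewrite distrC; apply: le_trans (Hv i s k) (le_trans _ Hk).
  rewrite ler_wpM2r ?exprn_ge0 // lerMn2r /= ler_wpM2l // ler_expR.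
  rewrite ler_wpM2l ?(ltW K_gt0) //.
  by rewrite -(subrK t s) addrC (le_trans (ler_normD _ _)) // lerD2l.
exists v; split=> [i|i t].
  apply/eqP; rewrite -subr_eq0 -normr_le0; apply/ler_addgt0Pl => e e0.
  rewrite addr0; have [k Hk] := half0 ((M * expR (K * `|0 : R|)) *+ 2) e (B0 _) e0.
  by have := Hv i 0 k; rewrite u00 distrC => H; exact: le_trans H Hk.
(* v and its Picard image are both within O(2^-k) of the iterate of order k + 1. *)
suff -> : v i = step v i by apply: step'.
apply/funext => s; apply/eqP; rewrite -subr_eq0 -normr_le0; apply/ler_addgt0Pl => e e0.
rewrite addr0.
have [k Hk] := half0 ((M * expR (K * `|s|)) *+ 2) e (B0 _) e0.
have h1 := Hv i s k.+1.
have h2 : `|u k.+1 i s - step v i s| <= (M *+ 2 * 2^-1 ^+ k) / 2 * expR (K * `|s|).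
  apply: (@picard_contraction (u k) v _ i).
  - by rewrite mulr_ge0 ?exprn_ge0 // mulrn_wge0.
  - by move=> j r; apply: le_trans (Hv j r k) _; rewrite -mulrnAl mulrAC.
  - by rewrite u00 step0.
  - by move=> r; exact: (step' (u k) i r (cu k)).
  - by move=> r; exact: (step' v i r cv).
apply: le_trans Hk.
rewrite -(subrKA (u k.+1 i s)) (le_trans (ler_normD _ _)) // distrC.
apply: le_trans (lerD h1 h2) _.
rewrite le_eqVlt; apply/orP; left; apply/eqP; rewrite exprS.
exact: half_add_half.
Qed.

End Picard.

(** * Differentiation along a direction *)

Section DerivativeRules.
Context {R : realType} {V : normedModType R}.
Implicit Types (f g : V -> R) (x v : V) (df dg : R).

(** Reduces calculus in several variables to the chain rule on the line. *)
Lemma is_derive_lineP f x v l :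
  is_derive x v f l <-> is_derive (0 : R) (1 : R) (fun h : R => f (h *: v + x)) l.
Proof.
have E : (fun h : R => h^-1 *: (f (h *: v + x) - f x)) =
    (fun h : R => h^-1 *: (f ((h *: (1 : R) + 0) *: v + x) - f (0 *: v + x))).
  by apply/funext => h; rewrite scale0r add0r addr0 [h *: 1]mulr1.
have DE : 'D_v f x = 'D_1 (fun h : R => f (h *: v + x)) 0.
  by rewrite /derive /= E.
have dP := derivable1P f x v.
split=> -[d <-]; [rewrite DE|rewrite -DE].
  exact: DeriveDef (proj1 dP d) (erefl _).
exact: DeriveDef (proj2 dP d) (erefl _).
Qed.

Lemma is_derive_add f g x v df dg :
  is_derive x v f df -> is_derive x v g dg ->
  is_derive x v (fun s => f s + g s) (df + dg).
Proof. by move=> ? ?; apply: is_deriveD. Qed.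

Lemma is_derive_sub f g x v df dg :
  is_derive x v f df -> is_derive x v g dg ->
  is_derive x v (fun s => f s - g s) (df - dg).
Proof. by move=> ? ?; apply: is_deriveB. Qed.

Lemma is_derive_mul f g x v df dg :
  is_derive x v f df -> is_derive x v g dg ->
  is_derive x v (fun s => f s * g s) (df * g x + f x * dg).
Proof.
move=> Hf Hg; rewrite addrC [df * _]mulrC; exact: (is_deriveM Hf Hg).
Qed.

Lemma is_derive_sqr f x v df : is_derive x v f df ->
  is_derive x v (fun s => f s ^+ 2) (2 * f x * df).
Proof.
move=> Hf; have -> : 2 * f x * df = df * f x + f x * df by ring.
exact: is_derive_mul.
Qed.

Lemma is_derive_comp (F : R -> R) g x v df dg :
  is_derive (g x) (1 : R) F df -> is_derive x v g dg ->
  is_derive x v (fun s => F (g s)) (df * dg).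
Proof.
move=> HF /is_derive_lineP Hg; apply/is_derive_lineP.
apply: (@is_derive1_comp _ F (fun h : R => g (h *: v + x))).
by rewrite scale0r add0r.
Qed.

Lemma is_derive_inv f x v df : f x != 0 -> is_derive x v f df ->
  is_derive x v (fun s => (f s)^-1) (- df / f x ^+ 2).
Proof.
move=> fx Hf.
have dV : is_derive (f x) (1 : R) (fun y => y^-1) (- (f x) ^- 2).
  by rewrite -[- _]mulr1; exact: (@is_deriveV _ id).
have -> : - df / f x ^+ 2 = - (f x) ^- 2 * df by rewrite mulrC mulrN mulNr.
exact: is_derive_comp dV Hf.
Qed.

End DerivativeRules.

(** * Truncation and globally Lipschitz fields *)

Section Clamp.
Context {R : realType}.
Implicit Types (r x y z : R).

Lemma sqr_sum3_le x y z :
  (`|x| + `|y| + `|z|) * (`|x| + `|y| + `|z|) <= 3 * (x ^+ 2 + y ^+ 2 + z ^+ 2).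
Proof.
rewrite -(real_normK (num_real x)) -(real_normK (num_real y)) -(real_normK (num_real z)).
move: `|x| `|y| `|z| => a b c; rewrite -subr_ge0.
have -> : 3 * (a ^+ 2 + b ^+ 2 + c ^+ 2) - (a + b + c) * (a + b + c) =
  (a - b) ^+ 2 + (b - c) ^+ 2 + (a - c) ^+ 2 by ring.
by rewrite !addr_ge0 // sqr_ge0.
Qed.

Definition clamp r x := if x < - r then - r else if r < x then r else x.

Lemma clamp_id r x : `|x| <= r -> clamp r x = x.
Proof. by rewrite ler_norml /clamp => /andP[? ?]; do 2 case: ltP => //; lra. Qed.

Lemma clamp_bounded r x : 0 <= r -> `|clamp r x| <= r.
Proof.
by move=> r0; rewrite ler_norml /clamp; do 2 case: ltP => ?; apply/andP; split; lra.
Qed.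

Lemma clamp_contract r x : 0 <= r -> `|clamp r x| <= `|x|.
Proof.
move=> r0; have x1 := ler_norm x; have := ler_norm (- x); rewrite normrN => x2.
by rewrite ler_norml /clamp; do 2 case: ltP => ?; apply/andP; split; lra.
Qed.

Lemma clamp_lipschitz r x y : 0 <= r -> `|clamp r x - clamp r y| <= `|x - y|.
Proof.
move=> r0; have h1 := ler_norm (x - y); have := ler_norm (- (x - y)).
rewrite normrN => h2.
by rewrite ler_norml /clamp; do 4 case: ltP => ?; apply/andP; split; lra.
Qed.

End Clamp.

Section BoundedLipschitz.
Context {R : realType}.
Implicit Types (f g : R -> R -> R -> R).

Definition lipschitz3 (L : R) f := forall a b c a' b' c',
  `|f a b c - f a' b' c'| <= L * (`|a - a'| + `|b - b'| + `|c - c'|).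

(** Boundedness is part of the class because it is what makes the class stable
    under products. *)
Definition bounded_lipschitz f := exists2 M : R, 0 <= M &
  lipschitz3 M f /\ forall a b c, `|f a b c| <= M.

Lemma bounded_lipschitz_cst k : bounded_lipschitz (fun _ _ _ => k).
Proof.
exists `|k| => //; split=> // a b c a' b' c'.
by rewrite subrr normr0 mulr_ge0 // !addr_ge0.
Qed.

Lemma bounded_lipschitz_clamp r : 0 <= r ->
  [/\ bounded_lipschitz (fun a _ _ => clamp r a),
      bounded_lipschitz (fun _ b _ => clamp r b) &
      bounded_lipschitz (fun _ _ c => clamp r c)].
Proof.
move=> r0; have r1 : 0 <= r + 1 by lra.
split; exists (r + 1) => //; split.
- move=> a b c a' b' c'; apply: le_trans (clamp_lipschitz a a' r0) _.
  rewrite -[leLHS]mul1r ler_pM //; first by lra.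
  by rewrite -addrA lerDl addr_ge0.
- by move=> a _ _; apply: le_trans (clamp_bounded a r0) _; lra.
- move=> a b c a' b' c'; apply: le_trans (clamp_lipschitz b b' r0) _.
  rewrite -[leLHS]mul1r ler_pM //; first by lra.
  by rewrite addrAC lerDr addr_ge0.
- by move=> _ a _; apply: le_trans (clamp_bounded a r0) _; lra.
- move=> a b c a' b' c'; apply: le_trans (clamp_lipschitz c c' r0) _.
  rewrite -[leLHS]mul1r ler_pM //; first by lra.
  by rewrite lerDr addr_ge0.
- by move=> _ _ a; apply: le_trans (clamp_bounded a r0) _; lra.
Qed.

Lemma bounded_lipschitzD f g : bounded_lipschitz f -> bounded_lipschitz g ->
  bounded_lipschitz (fun a b c => f a b c + g a b c).
Proof.
move=> [M M0 [Mf fM]] [N N0 [Ng gN]]; exists (M + N); first exact: addr_ge0.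
split=> [a b c a' b' c'|a b c].
  rewrite opprD addrACA mulrDl.
  by apply: le_trans (ler_normD _ _) _; apply: lerD; [exact: Mf|exact: Ng].
by apply: le_trans (ler_normD _ _) _; apply: lerD.
Qed.

Lemma bounded_lipschitzM f g : bounded_lipschitz f -> bounded_lipschitz g ->
  bounded_lipschitz (fun a b c => f a b c * g a b c).
Proof.
move=> [M M0 [Mf fM]] [N N0 [Ng gN]].
exists (M * N *+ 2); first by rewrite mulrn_wge0 // mulr_ge0.
split=> [a b c a' b' c'|a b c].
  set D := `|a - a'| + _ + _.
  have -> : f a b c * g a b c - f a' b' c' * g a' b' c' =
     f a b c * (g a b c - g a' b' c') + (f a b c - f a' b' c') * g a' b' c' by ring.
  apply: le_trans (ler_normD _ _) _; rewrite !normrM.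
  have -> : M * N *+ 2 * D = M * (N * D) + (M * D) * N by ring.
  have Df := Mf a b c a' b' c'; have Dg := Ng a b c a' b' c'.
  by apply: lerD; apply: ler_pM.
rewrite normrM (@le_trans _ _ (M * N)) // ?ler_pM // mulr2n lerDl.
exact: mulr_ge0.
Qed.

Lemma ode3_exists (g1 g2 g3 : R -> R -> R -> R) L x0 y0 z0 : 0 <= L ->
  lipschitz3 L g1 -> lipschitz3 L g2 -> lipschitz3 L g3 ->
  exists x y z : R -> R, [/\ x 0 = x0, y 0 = y0, z 0 = z0 & forall t,
    [/\ is_derive t (1 : R) x (g1 (x t) (y t) (z t)),
        is_derive t (1 : R) y (g2 (x t) (y t) (z t)) &
        is_derive t (1 : R) z (g3 (x t) (y t) (z t))]].
Proof.
move=> L0 L1 L2 L3.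
pose i0 : 'I_3 := inord 0; pose i1 : 'I_3 := inord 1; pose i2 : 'I_3 := inord 2.
pose G (a : 'I_3 -> R) (i : 'I_3) :=
  nth 0 [:: g1 (a i0) (a i1) (a i2); g2 (a i0) (a i1) (a i2); g3 (a i0) (a i1) (a i2)] i.
have GL (a b : 'I_3 -> R) i : `|G a i - G b i| <= L * \sum_j `|a j - b j|.
  have -> : \sum_j `|a j - b j| = `|a i0 - b i0| + `|a i1 - b i1| + `|a i2 - b i2|.
    rewrite !big_ord_recl big_ord0 addr0 !addrA.
    by congr (`|a _ - b _| + `|a _ - b _| + `|a _ - b _|);
      apply: val_inj; rewrite /= ?inordK.
  rewrite /G; case: i => -[|[|[|//]]] /= _.
  - exact: L1.
  - exact: L2.
  - exact: L3.
have [u [u0 du]] := lipschitz_ode_exists L0 GL (fun i => nth 0 [:: x0; y0; z0] i).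
exists (u i0), (u i1), (u i2); split; rewrite ?u0 ?inordK // => t.
by split; [have := du i0 t|have := du i1 t|have := du i2 t]; rewrite /G inordK.
Qed.

End BoundedLipschitz.

(** * Solutions near the source *)

Section Field.
Context {R : realType}.
Implicit Types (s lam w x y z rho : R).

Definition rhsW lam w x := w * (x ^+ 2 - lam * w ^+ 2).
Definition rhsX s lam w x y :=
  x ^+ 3 - x + y ^+ 2 / s + lam * (s - x) * w ^+ 2.
Definition rhsY s lam w x y := y * (x ^+ 2 - x / s - lam * w ^+ 2).

(** Right-hand side at (w, 1 + z, y) minus its linear part at the equilibrium;
    likewise for the next two. *)
Definition nonlinW lam w z := w * (2 * z + z * z - lam * (w * w)).
Definition nonlinX s lam w z y :=
  3 * (z * z) + z * z * z + y * y * s^-1 + lam * (s - 1 - z) * (w * w).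
Definition nonlinY s lam w z y :=
  y * (2 * z + z * z - z * s^-1 - lam * (w * w)).

Lemma rhsW_split lam w z : rhsW lam w (1 + z) = w + nonlinW lam w z.
Proof. by rewrite /rhsW /nonlinW; ring. Qed.

Lemma rhsX_split s lam w z y :
  rhsX s lam w (1 + z) y = 2 * z + nonlinX s lam w z y.
Proof. by rewrite /rhsX /nonlinX; ring. Qed.

Lemma rhsY_split s lam w z y :
  rhsY s lam w (1 + z) y = (1 - s^-1) * y + nonlinY s lam w z y.
Proof. by rewrite /rhsY /nonlinY; ring. Qed.

Section Small.
Variables (s lam rho : R).
Hypothesis s1 : 1 < s.
Hypothesis rho0 : 0 < rho.
Hypothesis rho1 : rho <= 1.
Let C := 4 + `|lam| * s.

Let prod_small w z : `|w| <= rho -> `|z| <= rho -> `|w * z| <= rho * `|z|.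
Proof. by move=> hw hz; rewrite normrM ler_wpM2r. Qed.

Let prod_small1 w z : `|w| <= rho -> `|z| <= rho -> `|w * z| <= rho.
Proof.
move=> hw hz; rewrite normrM -[leRHS]mulr1 ler_pM //.
exact: le_trans hz rho1.
Qed.

Let s0 : 0 < s. Proof. exact: lt_trans ltr01 s1. Qed.
Let sV0 : 0 < s^-1. Proof. by rewrite invr_gt0. Qed.
Let sV1 : s^-1 <= 1. Proof. by rewrite invf_le1 // ltW. Qed.

(** Each term of the remainder has degree at least two, so on a box of side rho
    it is at most rho times a multiple of the size of the point. *)
Lemma nonlin_small w z y : `|w| <= rho -> `|z| <= rho -> `|y| <= rho ->
  let B := C * rho * (`|w| + `|z| + `|y|) in
  [/\ `|nonlinW lam w z| <= B, `|nonlinX s lam w z y| <= B &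
      `|nonlinY s lam w z y| <= B].
Proof.
move=> hw hz hy B.
have w0 := normr_ge0 w; have z0 := normr_ge0 z; have y0 := normr_ge0 y.
have l0 := normr_ge0 lam.
have ls : `|lam| <= `|lam| * s by rewrite ler_peMr // ltW.
have ww := prod_small1 hw hw; have zz := prod_small1 hz hz.
have lww : `|lam * (w * w)| <= `|lam| * s * rho.
  by rewrite normrM; apply: ler_pM.
have z2 : `|2 * z| <= 2 * rho by rewrite normrM ger0_norm // ler_wpM2l.
have zs : `|z * s^-1| <= rho.
  by rewrite normrM (gtr0_norm sV0) -[leRHS]mulr1 ler_pM // ltW.
have BE t : 0 <= t -> t <= `|w| + `|z| + `|y| -> t * (C * rho) <= B.
  move=> t0 tS; rewrite mulrC /B ler_wpM2l //.
  by rewrite mulr_ge0 ?ltW // /C; nra.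
split.
- apply: (@le_trans _ _ (`|w| * (C * rho))); last by apply: BE => //; lra.
  rewrite normrM ler_wpM2l // /C.
  apply: le_trans (ler_normB _ _) _.
  apply: le_trans (lerD (ler_normD _ _) (lexx _)) _; nra.
- have -> : B = 4 * rho * `|z| + rho * `|y| + `|lam| * s * rho * `|w| +
     ((4 + `|lam| * s) * rho * `|w| - `|lam| * s * rho * `|w|) +
     `|lam| * s * rho * `|z| + ((4 + `|lam| * s) * rho * `|y| - rho * `|y|).
    by rewrite /B /C; ring.
  have h1 : `|3 * (z * z)| <= 3 * (rho * `|z|).
    by rewrite normrM ger0_norm // ler_wpM2l // prod_small.
  have h2 : `|z * z * z| <= rho * `|z| by rewrite normrM ler_wpM2r.
  have h3 : `|y * y * s^-1| <= rho * `|y|.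
    rewrite normrM (gtr0_norm sV0) -[leRHS]mulr1; by rewrite ler_pM ?prod_small // ltW.
  have h4 : `|lam * (s - 1 - z) * (w * w)| <= `|lam| * s * (rho * `|w|).
    rewrite normrM; apply: ler_pM => //; last exact: prod_small.
    rewrite normrM; apply: ler_pM => //.
    have := s1; have := rho1; move: hz.
    by rewrite !ler_norml => /andP[? ?] ? ?; apply/andP; split; lra.
  have p1 : 0 <= rho * `|w| by rewrite mulr_ge0 // ltW.
  have p2 : 0 <= `|lam| * s * rho * `|z|.
    by rewrite !mulr_ge0 // ?ltW // (lt_trans _ s1).
  have p3 : 0 <= `|lam| * s * rho * `|y|.
    by rewrite !mulr_ge0 // ?ltW // (lt_trans _ s1).
  have p4 : 0 <= rho * `|y| by rewrite mulr_ge0 // ltW.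
  rewrite /nonlinX; apply: le_trans (ler_normD _ _) _.
  apply: le_trans (lerD (ler_normD _ _) (lexx _)) _.
  apply: le_trans (lerD (lerD (ler_normD _ _) (lexx _)) (lexx _)) _.
  lra.
- apply: (@le_trans _ _ (`|y| * (C * rho))); last by apply: BE => //; lra.
  rewrite normrM ler_wpM2l // /C.
  apply: le_trans (ler_normB _ _) _.
  apply: le_trans (lerD (ler_normB _ _) (lexx _)) _.
  apply: le_trans (lerD (lerD (ler_normD _ _) (lexx _)) (lexx _)) _; nra.
Qed.

End Small.

(** The quadratic form of the linear part is at least b |u|^2 (twice this in
    V'), while the remainder costs at most 6 k |u|^2 = (b / 2) |u|^2. *)
Lemma energy_growth (b k w z y nw nz ny : R) : 0 < b -> b < 1 -> k = b / 12 ->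
  let S := `|w| + `|z| + `|y| in
  `|nw| <= k * S -> `|nz| <= k * S -> `|ny| <= k * S ->
  b * (w ^+ 2 + z ^+ 2 + y ^+ 2) <=
  2 * w * (w + nw) + 2 * z * (2 * z + nz) + 2 * y * (b * y + ny).
Proof.
move=> b0 b1 kE S hw hz hy.
have aux u v : `|v| <= k * S -> - (`|u| * (k * S)) <= u * v.
  move=> hv; have : `|u * v| <= `|u| * (k * S) by rewrite normrM ler_wpM2l.
  by rewrite ler_norml => /andP[].
have {}hw := aux w _ hw; have {}hz := aux z _ hz; have {}hy := aux y _ hy.
have S2 : S * S <= 3 * (w ^+ 2 + z ^+ 2 + y ^+ 2) := sqr_sum3_le w z y.
have k0 : 0 <= k by rewrite kE divr_ge0 // ltW.
have kS : k * (S * S) <= b / 4 * (w ^+ 2 + z ^+ 2 + y ^+ 2).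
  apply: le_trans (ler_wpM2l k0 S2) _; rewrite kE; lra.
have E : `|w| * (k * S) + `|z| * (k * S) + `|y| * (k * S) = k * (S * S).
  by rewrite /S; ring.
have w2 : b * w ^+ 2 <= w ^+ 2 by rewrite ler_piMl ?sqr_ge0 // ltW.
have z2 : b * z ^+ 2 <= z ^+ 2 by rewrite ler_piMl ?sqr_ge0 // ltW.
have bw := mulr_ge0 (ltW b0) (sqr_ge0 w).
have bz := mulr_ge0 (ltW b0) (sqr_ge0 z).
have by_ := mulr_ge0 (ltW b0) (sqr_ge0 y).
have sw := sqr_ge0 w; have sz := sqr_ge0 z; have sy := sqr_ge0 y.
have -> : 2 * w * (w + nw) + 2 * z * (2 * z + nz) + 2 * y * (b * y + ny) =
  2 * w ^+ 2 + 4 * z ^+ 2 + 2 * (b * y ^+ 2) + 2 * (w * nw + z * nz + y * ny) by ring.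
have : b * (w ^+ 2 + z ^+ 2 + y ^+ 2) = b * w ^+ 2 + b * z ^+ 2 + b * y ^+ 2 by ring.
move: kS E bw bz by_ w2 z2 hw hz hy sw sz sy.
move: (b * w ^+ 2) (b * z ^+ 2) (b * y ^+ 2) => bw bz by_.
lra.
Qed.

(** The truncation acts only on the nonlinear remainder: with the linear part
    left untouched, the energy estimate holds at every point of space. *)
Lemma soliton_flow s lam : 1 < s -> exists2 rho, 0 < rho &
  forall w0 x0 y0, `|w0| < rho / 2 -> `|x0 - 1| < rho / 2 -> `|y0| < rho / 2 ->
  exists W X Y : R -> R,
  [/\ [/\ W 0 = w0, X 0 = x0 & Y 0 = y0],
      continuous W /\ continuous X,
      forall t : R, t <= 0 ->
        [/\ is_derive t (1 : R) W (rhsW lam (W t) (X t)),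
            is_derive t (1 : R) X (rhsX s lam (W t) (X t) (Y t)) &
            is_derive t (1 : R) Y (rhsY s lam (W t) (X t) (Y t))] &
      forall t : R, t <= 0 -> let D := expR ((1 - s^-1) / 2 * t) in
        [/\ `|W t| <= D, `|X t - 1| <= D & `|Y t| <= D]].
Proof.
move=> s1; set b := 1 - s^-1.
have sV0 : 0 < s^-1 by rewrite invr_gt0; lra.
have sV1 : s^-1 < 1 by rewrite invf_lt1; lra.
have b0 : 0 < b by rewrite /b; lra.
have b1 : b < 1 by rewrite /b; lra.
pose C := 4 + `|lam| * s.
have C4 : 4 <= C by rewrite /C lerDl mulr_ge0 //; lra.
(* Chosen so that the remainder bound C rho equals b / 12, as in the energy estimate. *)
pose rho := b / 12 / C.
have rho0 : 0 < rho by rewrite !divr_gt0 //; lra.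
have CrE : C * rho = b / 12 by rewrite /rho mulrC divfK // gt_eqF //; lra.
have rho1 : rho <= 1 by rewrite /rho ler_pdivrMr; lra.
exists rho => // w0 x0 y0 hw0 hx0 hy0.
pose c := clamp rho.
have [c1 c2 c3] := bounded_lipschitz_clamp (ltW rho0).
have blc := @bounded_lipschitz_cst R.
have NW : bounded_lipschitz (fun w z y => nonlinW lam (c w) (c z)).
  apply: (bounded_lipschitzM c1); apply: (@bounded_lipschitzD _ _ (fun w _ _ => - (lam * (c w * c w)))).
    by apply: bounded_lipschitzD; apply: bounded_lipschitzM.
  rewrite (_ : (fun w _ _ => _) = (fun w _ _ => (- lam) * (c w * c w))); last first.
    by apply/funext => a; apply/funext => ?; apply/funext => ?; rewrite mulNr.
  by do 2 apply: bounded_lipschitzM => //.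
have NX : bounded_lipschitz (fun w z y => nonlinX s lam (c w) (c z) (c y)).
  apply: bounded_lipschitzD; first apply: bounded_lipschitzD; first apply: bounded_lipschitzD.
  - by do 2 apply: bounded_lipschitzM => //.
  - by do 2 apply: bounded_lipschitzM => //.
  - by do 2 apply: bounded_lipschitzM => //.
  - apply: bounded_lipschitzM; last exact: bounded_lipschitzM.
    apply: bounded_lipschitzM => //; apply: (@bounded_lipschitzD _ (fun _ _ _ => s - 1) (fun _ z _ => - c z)) => //.
    rewrite (_ : (fun _ z _ => _) = (fun _ z _ => (- 1) * c z)); last first.
      by apply/funext => ?; apply/funext => a; apply/funext => ?; rewrite mulN1r.
    exact: bounded_lipschitzM.
have NY : bounded_lipschitz (fun w z y => nonlinY s lam (c w) (c z) (c y)).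
  rewrite (_ : (fun w z y => _) = (fun w z y =>
    c y * (2 * c z + c z * c z + (- s^-1) * c z + (- lam) * (c w * c w)))); last first.
    apply/funext => ?; apply/funext => a; apply/funext => ?.
    by rewrite /nonlinY; ring.
  apply: bounded_lipschitzM => //; apply: bounded_lipschitzD; last by do 2 apply: bounded_lipschitzM => //.
  apply: bounded_lipschitzD; last exact: bounded_lipschitzM.
  by apply: bounded_lipschitzD; exact: bounded_lipschitzM.
have [MW MW0 [LW _]] := NW; have [MX MX0 [LX _]] := NX; have [MY MY0 [LY _]] := NY.
(* 2 is the largest coefficient of the linear part. *)
pose L := 2 + MW + MX + MY.
have L0 : 0 <= L by rewrite /L; lra.
have lipL (M e : R) (g h : R -> R -> R -> R) : 0 <= e -> e <= 2 -> lipschitz3 M g ->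
    M <= MW + MX + MY -> (forall a b c a' b' c', `|h a b c - h a' b' c'| <=
       e * (`|a - a'| + `|b - b'| + `|c - c'|)) ->
    lipschitz3 L (fun a b c => h a b c + g a b c).
  move=> e0 e2 Lg ML Lh x y z x' y' z'; rewrite opprD addrACA.
  apply: le_trans (ler_normD _ _) _.
  apply: le_trans (lerD (Lh _ _ _ _ _ _) (Lg _ _ _ _ _ _)) _.
  by rewrite -mulrDl ler_wpM2r ?addr_ge0 // /L; lra.
have [W [Z [Y [W0 Z0 Y0 dWZY]]]] := @ode3_exists R
  (fun w z y => w + nonlinW lam (c w) (c z))
  (fun w z y => 2 * z + nonlinX s lam (c w) (c z) (c y))
  (fun w z y => b * y + nonlinY s lam (c w) (c z) (c y)) L w0 (x0 - 1) y0 L0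
  ltac:(apply: (lipL MW 1 _ _ ler01 _ LW) => [||*]; [lra|lra|rewrite mul1r -addrA lerDl addr_ge0 //])
  ltac:(apply: (lipL MX 2 _ _ (ler0n _ _) _ LX) => [||*]; [lra|lra|
    rewrite -mulrBr normrM ger0_norm // ler_wpM2l // addrAC lerDr addr_ge0 //])
  ltac:(apply: (lipL MY 1 _ _ ler01 _ LY) => [||*]; [lra|lra|
    rewrite -mulrBr normrM gtr0_norm // ler_pM // ?(ltW b0) // ?(ltW b1) // lerDr addr_ge0 //]).
pose V t := W t ^+ 2 + Z t ^+ 2 + Y t ^+ 2.
pose V' t := 2 * W t * (W t + nonlinW lam (c (W t)) (c (Z t))) +
  2 * Z t * (2 * Z t + nonlinX s lam (c (W t)) (c (Z t)) (c (Y t))) +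
  2 * Y t * (b * Y t + nonlinY s lam (c (W t)) (c (Z t)) (c (Y t))).
have dV t : is_derive t (1 : R) V (V' t).
  have [dW dZ dY] := dWZY t.
  by apply: is_derive_add; [apply: is_derive_add|]; apply: is_derive_sqr.
have V'b t : b * V t <= V' t.
  have cr (x : R) : `|c x| <= rho := clamp_bounded x (ltW rho0).
  have cx (x : R) : `|c x| <= `|x| := clamp_contract x (ltW rho0).
  have [] := @nonlin_small s lam rho s1 rho0 rho1 (c (W t)) (c (Z t)) (c (Y t))
    (cr _) (cr _) (cr _).
  rewrite -/C CrE => hW hX hY.
  have Sle : b / 12 * (`|c (W t)| + `|c (Z t)| + `|c (Y t)|) <=
    b / 12 * (`|W t| + `|Z t| + `|Y t|).
    by rewrite ler_wpM2l ?divr_ge0 ?(ltW b0) // !lerD.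
  by apply: energy_growth (le_trans hW Sle) (le_trans hX Sle) (le_trans hY Sle).
have Vdecay t : t <= 0 -> V t <= rho ^+ 2 * expR (b * t).
  move=> t0.
  have dh (r : R) : t <= r <= 0 -> is_derive r (1 : R) (fun u => V u * expR (- b * u))
      ((V' r - b * V r) * expR (- b * r)).
    move=> _; have -> : (V' r - b * V r) * expR (- b * r) =
      V' r * expR (- b * r) + V r * (- b * expR (- b * r)) by ring.
    apply: is_derive_mul (dV r) _; exact: is_derive_expRM.
  have := ge0_derive_homo t0 dh _; rewrite mulr0 expR0 mulr1 => H.
  have {}H : V t * expR (- b * t) <= V 0.
    by apply: H => r _; rewrite mulr_ge0 ?expR_ge0 // subr_ge0.
  rewrite mulNr expRN ler_pdivrMr ?expR_gt0 // in H.
  apply: le_trans H _; rewrite ler_wpM2r ?expR_ge0 //.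
  (* Three squares below rho^2 / 4 add up to less than rho^2. *)
  have sq (x : R) : `|x| < rho / 2 -> x ^+ 2 <= rho ^+ 2 / 4.
    rewrite ltr_norml => /andP[? ?]; have := ltW rho0; nra.
  rewrite /V W0 Z0 Y0; have := sq _ hw0; have := sq _ hx0; have := sq _ hy0.
  have := sqr_ge0 rho; lra.
have bound t : t <= 0 -> let D := rho * expR (b / 2 * t) in
    [/\ `|W t| <= D, `|Z t| <= D & `|Y t| <= D].
  move=> t0 D; have D0 : 0 <= D by rewrite mulr_ge0 ?expR_ge0 // ltW.
  have D2 : rho ^+ 2 * expR (b * t) = D ^+ 2.
    have -> : expR (b * t) = expR (b / 2 * t) ^+ 2.
      by rewrite -expRM_natl; congr expR; field.
    by rewrite /D; ring.
  have := Vdecay t t0; rewrite D2 /V => H.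
  have aux (x : R) : x ^+ 2 <= D ^+ 2 -> `|x| <= D.
    by rewrite -(real_normK (num_real x)) ler_pXn2r ?nnegrE.
  have := sqr_ge0 (W t); have := sqr_ge0 (Y t); have := sqr_ge0 (Z t).
  by split; apply: aux; lra.
exists W, (fun t => 1 + Z t), Y.
have cW : continuous W by move=> t; have [d _ _] := dWZY t; exact: is_derive_continuous d.
have cZ : continuous Z by move=> t; have [_ d _] := dWZY t; exact: is_derive_continuous d.
split.
- by split=> //; rewrite Z0; ring.
- by split=> // t; apply: continuousD; [exact: cst_continuous|exact: cZ].
- move=> t t0; have [hW hZ hY] := bound t t0.
  have e1 : expR (b / 2 * t) <= 1.
    by rewrite expR_le1; have := ltW b0; nra.
  have in_box (x : R) : `|x| <= rho * expR (b / 2 * t) -> c x = x.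
    move=> hx; apply: clamp_id; apply: le_trans hx _.
    by rewrite ler_piMr // ltW.
  have := dWZY t; rewrite !in_box // => -[dW dZ dY].
  rewrite rhsW_split rhsX_split rhsY_split; split=> //.
  by rewrite -[2 * _ + _]add0r; apply: is_derive_add.
- move=> t t0 D; have [hW hZ hY] := bound t t0.
  have rD : rho * expR (b / 2 * t) <= D by rewrite ler_piMl // expR_ge0.
  by rewrite [1 + _]addrC addrK; split; exact: le_trans rD.
Qed.

End Field.

(** * One-sided derivatives and uniqueness *)

Section DerivativeWithin.
Context {R : realType}.
Implicit Types (f : R -> R) (J : set R) (y l : R).

(** Through the slope function of Caratheodory, continuous at y. *)
Lemma is_derive_within J f y l :
  is_derive y (1 : R) f l -> derivative_within J f y l.
Proof.
move=> /is_derive1_caratheodory[g [fE cg <-]].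
have : g z @[z --> within J y^'] --> g y.
  apply: cvg_trans cg; apply: cvg_app => A yA.
  exact: (@cvg_within _ y^' _ J A (@cvg_within _ (nbhs y) _ _ A yA)).
apply: cvg_trans; apply: near_eq_cvg.
have zy0 : \forall z \near y^', z != y by exact: nbhs_dnbhs_neq.
have zy : \forall z \near within J y^', z != y.
  exact: (@cvg_within _ y^' _ J _ zy0).
near=> z.
rewrite fE mulfK // subr_eq0; by near: z.
Unshelve. all: by end_near. Qed.

Lemma derivative_within_cvg J f y l (F : set_system R) : Filter F ->
  derivative_within J f y l -> F --> y -> (\forall z \near F, z != y /\ J z) ->
  (f z - f y) / (z - y) @[z --> F] --> l /\ f z @[z --> F] --> f y.
Proof.
move=> FF df Fy FJ.
have q : (f z - f y) / (z - y) @[z --> F] --> l.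
  apply: cvg_trans df; apply: cvg_app => A; rewrite /within /dnbhs /= => HA.
  have HA' : \forall z \near F, z != y -> J z -> A z by exact: Fy.
  near=> z; have [zy Jz] : z != y /\ J z by near: z.
  by apply: (near HA' z).
split=> //.
have -> : f y = f y + l * (y - y) by rewrite subrr mulr0 addr0.
have : f y + (f z - f y) / (z - y) * (z - y) @[z --> F] --> f y + l * (y - y).
  apply: cvgD; first exact: cvg_cst.
  by apply: cvgM => //; apply: cvgB => //; exact: cvg_cst.
apply: cvg_trans; apply: near_eq_cvg; near=> z.
have [zy _] : z != y /\ J z by near: z.
by rewrite divfK ?subr_eq0 // addrC subrK.
Unshelve. all: by end_near. Qed.

Lemma derivative_within_is_derive J f y l : (\forall z \near y, J z) ->
  derivative_within J f y l -> is_derive y (1 : R) f l.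
Proof.
move=> yJ df; apply/is_derive1_caratheodory.
have [||q _] := derivative_within_cvg _ df (F := y^').
- exact: cvg_within.
- near=> z; split; last by near: z; exact: nbhs_dnbhs.
  by near: z; exact: nbhs_dnbhs_neq.
exists (fun z => if z == y then l else (f z - f y) / (z - y)); split.
- move=> z; case: eqP => [->|/eqP zy]; first by rewrite !subrr mulr0.
  by rewrite divfK // subr_eq0.
- apply/continuous_withinNx; rewrite eqxx.
  apply: cvg_trans q; apply: near_eq_cvg; near=> z.
  rewrite ifF //; apply/negbTE; near: z; exact: nbhs_dnbhs_neq.
- by rewrite eqxx.
Unshelve. all: by end_near. Qed.

Lemma derivative_within_continuous a b f (f' : R -> R) : a < b ->
  (forall y, `[a, b]%classic y -> derivative_within `[a, b] f y (f' y)) ->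
  {within `[a, b], continuous f}.
Proof.
move=> ab df; apply/continuous_within_itvP => //; split.
- move=> y; rewrite in_itv/= => /andP[ay yb].
  apply: (@is_derive_continuous _ f y (f' y)).
  apply: derivative_within_is_derive (df y _); last by rewrite /= in_itv/= !ltW.
  near=> z; rewrite /= in_itv/=; apply/andP; split; apply: ltW.
    by near: z; exact: lt_nbhsr.
  by near: z; exact: lt_nbhsl.
- apply: (derivative_within_cvg _ (df a _) _ _).2.
  + by rewrite /= in_itv/= lexx ltW.
  + exact: cvg_within.
  + near=> z; split; first by rewrite gt_eqF.
    by rewrite /= in_itv/=; apply/andP; split; [|near: z; exact: nbhs_right_le].
- apply: (derivative_within_cvg _ (df b _) _ _).2.
  + by rewrite /= in_itv/= lexx ltW.
  + exact: cvg_within.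
  + near=> z; split; first by rewrite lt_eqF.
    by rewrite /= in_itv/=; apply/andP; split; [near: z; exact: nbhs_left_ge|].
Unshelve. all: by end_near. Qed.

Lemma within_continuous_bounded a b f : a <= b ->
  {within `[a, b], continuous f} -> exists2 M, 0 <= M & forall y, a <= y <= b -> `|f y| <= M.
Proof.
move=> ab cf; have [c _ cM] := EVT_max ab cf; have [d _ dM] := EVT_min ab cf.
exists (`|f c| + `|f d|); first by rewrite addr_ge0.
move=> y yab; rewrite ler_norml.
have := cM y; have := dM y; rewrite !in_itv/= => /(_ yab) h1 /(_ yab) h2.
have := ler_norm (f c); have := ler_norm (- f d); rewrite normrN.
have := normr_ge0 (f c); have := normr_ge0 (f d).
by move=> *; apply/andP; split; lra.
Qed.

(** E(y) exp(K y) is nondecreasing and vanishes at 0. *)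
Lemma gronwall_backward (E E' : R -> R) K a : a < 0 ->
  {within `[a, 0], continuous E} ->
  (forall y, a < y < 0 -> is_derive y (1 : R) E (E' y)) ->
  (forall y, a < y < 0 -> - K * E y <= E' y) ->
  (forall y, 0 <= E y) -> E 0 = 0 ->
  forall y, a <= y <= 0 -> E y = 0.
Proof.
move=> a0 cE dE hE E0 E00 y /andP[ay]; rewrite le_eqVlt => /orP[/eqP->//|y0].
pose h t := E t * expR (K * t).
pose h' t := E' t * expR (K * t) + E t * (K * expR (K * t)).
have dh t : t \in `]y, 0[%R -> is_derive t (1 : R) h (h' t).
  rewrite in_itv/= => /andP[yt t0].
  apply: is_derive_mul (is_derive_expRM _ _); apply: dE.
  by rewrite t0 (le_lt_trans ay).
have ch : {within `[y, 0], continuous h}.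
  have ce : continuous (fun t => expR (K * t)).
    by move=> t; exact: is_derive_continuous (is_derive_expRM _ _).
  have cE' : {within `[y, 0], continuous E}.
    by apply: continuous_subspaceW cE; apply: subset_itvr; rewrite bnd_simp.
  by move=> t; apply: cvgM; [exact: cE'|exact: (continuous_subspaceT ce)].
have [c] := MVT y0 dh ch; rewrite in_itv/= => /andP[yc c0].
have ac : a < c < 0 by rewrite c0 (le_lt_trans ay).
have h'c : 0 <= h' c.
  have -> : h' c = (E' c - (- K * E c)) * expR (K * c) by rewrite /h'; ring.
  by rewrite mulr_ge0 ?expR_ge0 // subr_ge0 hE.
rewrite {1}/h E00 mul0r sub0r add0r => hy.
have : h y <= 0.
  by rewrite -oppr_ge0 hy mulr_ge0 // oppr_ge0 ltW.
rewrite /h pmulr_lle0 ?expR_gt0 // => Ey.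
by apply/eqP; rewrite eq_le Ey E0.
Qed.

(** In particular f keeps the sign of its initial value, which is how W and Y
    stay positive. *)
Lemma integrating_factor (f g : R -> R) : continuous g ->
  (forall t : R, t <= 0 -> is_derive t (1 : R) f (f t * g t)) ->
  exists P : R -> R, [/\ P 0 = 0, forall t, is_derive t (1 : R) P (g t) &
    forall t : R, t <= 0 -> f t = f 0 * expR (P t)].
Proof.
move=> cg df; have [P [P0 dP]] := primitive_exists cg.
exists P; split=> // t t0.
have d0 (s : R) : t <= s <= 0 -> is_derive s (1 : R) (fun s => f s * expR (- P s)) 0.
  move=> /andP[_ s0].
  have -> : (0 : R) = f s * g s * expR (- P s) + f s * (expR (- P s) * - g s) by ring.
  exact: is_derive_mul (df s s0) _.
have := derive0_eq t0 d0; rewrite P0 oppr0 expR0 mulr1 => <-.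
by rewrite -mulrA -expRD addNr expR0 mulr1.
Qed.

End DerivativeWithin.

Section Uniqueness.
Context {R : realType}.

(** The polynomial field is only locally Lipschitz, but on a compact interval
    both solutions stay in a box, and truncating to that box changes neither of
    them. *)
Lemma soliton_unique (n : nat) (lam a : R) (W X Y W1 X1 Y1 : R -> R) : a < 0 ->
  soliton_system n lam `[a, 0] W X Y -> soliton_system n lam `[a, 0] W1 X1 Y1 ->
  W1 0 = W 0 -> X1 0 = X 0 -> Y1 0 = Y 0 ->
  forall y, a <= y <= 0 -> [/\ W1 y = W y, X1 y = X y & Y1 y = Y y].
Proof.
move=> a0 H H1 W00 X00 Y00; set s := Num.sqrt (n%:R : R).
have [cW cX cY] : [/\ {within `[a, 0], continuous W}, {within `[a, 0], continuous X} &
    {within `[a, 0], continuous Y}].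
  by split; apply: derivative_within_continuous a0 _ => y Jy; have [dW dX dY] := H y Jy;
    [exact: dW|exact: dX|exact: dY].
have [cW1 cX1 cY1] : [/\ {within `[a, 0], continuous W1}, {within `[a, 0], continuous X1} &
    {within `[a, 0], continuous Y1}].
  by split; apply: derivative_within_continuous a0 _ => y Jy; have [dW dX dY] := H1 y Jy;
    [exact: dW|exact: dX|exact: dY].
have bd := fun f => @within_continuous_bounded R a 0 f (ltW a0).
have [M1 p1 HM1] := bd _ cW; have [M2 p2 HM2] := bd _ cX; have [M3 p3 HM3] := bd _ cY.
have [M4 p4 HM4] := bd _ cW1; have [M5 p5 HM5] := bd _ cX1; have [M6 p6 HM6] := bd _ cY1.
(* A box that contains both solutions on [a, 0]. *)
pose M := M1 + M2 + M3 + M4 + M5 + M6.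
have M0 : 0 <= M by rewrite !addr_ge0.
pose c := clamp M.
have inbox : forall y, a <= y <= 0 -> [/\ c (W y) = W y, c (X y) = X y & c (Y y) = Y y] /\
   [/\ c (W1 y) = W1 y, c (X1 y) = X1 y & c (Y1 y) = Y1 y].
  move=> y yJ.
  have cl N f : (forall y, a <= y <= 0 -> `|f y| <= N) -> N <= M -> c (f y) = f y.
    by move=> Hf NM; apply: clamp_id; exact: le_trans (Hf y yJ) NM.
  by split; split; [apply: (cl _ _ HM1)|apply: (cl _ _ HM2)|apply: (cl _ _ HM3)|
    apply: (cl _ _ HM4)|apply: (cl _ _ HM5)|apply: (cl _ _ HM6)]; rewrite /M; lra.
have [c1 c2 c3] := bounded_lipschitz_clamp M0.
have blc := @bounded_lipschitz_cst R.
have bW2 : bounded_lipschitz (fun w _ _ => (- lam) * (c w * c w)).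
  by do 2 apply: bounded_lipschitzM => //.
have [LW LW0 [lW _]] : bounded_lipschitz (fun w x y => rhsW lam (c w) (c x)).
  rewrite (_ : (fun w x y => _) = (fun w x y =>
    c w * (c x * c x + (- lam) * (c w * c w)))); last first.
    by apply/funext => ?; apply/funext => ?; apply/funext => ?; rewrite /rhsW; ring.
  by apply: bounded_lipschitzM => //; apply: bounded_lipschitzD => //; apply: bounded_lipschitzM.
have [LX LX0 [lX _]] : bounded_lipschitz (fun w x y => rhsX s lam (c w) (c x) (c y)).
  rewrite (_ : (fun w x y => _) = (fun w x y =>
    c x * (c x * c x) + (- 1) * c x + (c y * c y) * s^-1 +
      (s + (- 1) * c x) * (lam * (c w * c w)))); last first.
    by apply/funext => ?; apply/funext => ?; apply/funext => ?; rewrite /rhsX; ring.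
  apply: bounded_lipschitzD; first apply: bounded_lipschitzD; first apply: bounded_lipschitzD.
  - by do 2 apply: bounded_lipschitzM => //.
  - by apply: bounded_lipschitzM.
  - by do 2 apply: bounded_lipschitzM => //.
  - apply: bounded_lipschitzM; last by do 2 apply: bounded_lipschitzM => //.
    by apply: bounded_lipschitzD => //; apply: bounded_lipschitzM.
have [LY LY0 [lY _]] : bounded_lipschitz (fun w x y => rhsY s lam (c w) (c x) (c y)).
  rewrite (_ : (fun w x y => _) = (fun w x y =>
    c y * (c x * c x + (- s^-1) * c x + (- lam) * (c w * c w)))); last first.
    by apply/funext => ?; apply/funext => ?; apply/funext => ?; rewrite /rhsY; ring.
  apply: bounded_lipschitzM => //; apply: bounded_lipschitzD => //.
  by apply: bounded_lipschitzD; apply: bounded_lipschitzM.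
pose L := LW + LX + LY.
pose E y := (W1 y - W y) ^+ 2 + (X1 y - X y) ^+ 2 + (Y1 y - Y y) ^+ 2.
pose dW y := rhsW lam (W1 y) (X1 y) - rhsW lam (W y) (X y).
pose dX y := rhsX s lam (W1 y) (X1 y) (Y1 y) - rhsX s lam (W y) (X y) (Y y).
pose dY y := rhsY s lam (W1 y) (X1 y) (Y1 y) - rhsY s lam (W y) (X y) (Y y).
pose E' y := 2 * (W1 y - W y) * dW y + 2 * (X1 y - X y) * dX y + 2 * (Y1 y - Y y) * dY y.
have E0 y : 0 <= E y by rewrite !addr_ge0 // sqr_ge0.
have EE : forall y, a <= y <= 0 -> E y = 0.
  apply: (@gronwall_backward R E E' (6 * L) a a0) => //.
  - have sq (f g : R -> R) : {within `[a, 0], continuous f} ->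
      {within `[a, 0], continuous g} ->
      {within `[a, 0], continuous (fun y => (f y - g y) ^+ 2)}.
      by move=> cf cg y; apply: cvgM; apply: cvgB; [exact: cf|exact: cg|exact: cf|exact: cg].
    move=> y; apply: cvgD; last exact: (sq _ _ cY1 cY y).
    by apply: cvgD; [exact: (sq _ _ cW1 cW y)|exact: (sq _ _ cX1 cX y)].
  - move=> y /andP[ay y0]; have yJ : `[a, 0]%classic y by rewrite /= in_itv/= !ltW.
    have nJ : \forall z \near y, `[a, 0]%classic z.
      near=> z; rewrite /= in_itv/=; apply/andP; split; apply: ltW.
        by near: z; exact: lt_nbhsr.
      by near: z; exact: lt_nbhsl.
    have [a1 a2 a3] := H y yJ; have [b1 b2 b3] := H1 y yJ.
    by apply: is_derive_add; [apply: is_derive_add|]; apply: is_derive_sqr;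
      apply: is_derive_sub; apply: derivative_within_is_derive nJ _.
  - move=> y /andP[ay y0]; have yJ : a <= y <= 0 by rewrite !ltW.
    have [[e1 e2 e3] [f1 f2 f3]] := inbox y yJ.
    pose S := `|W1 y - W y| + `|X1 y - X y| + `|Y1 y - Y y|.
    have S0 : 0 <= S by rewrite !addr_ge0.
    have up K : 0 <= K -> K <= L -> K * S <= L * S by move=> _ KL; rewrite ler_wpM2r.
    have hW : `|dW y| <= L * S.
      have := lW (W1 y) (X1 y) (Y1 y) (W y) (X y) (Y y); rewrite e1 e2 f1 f2 => h.
      by apply: le_trans h (up _ LW0 _); rewrite /L; lra.
    have hX : `|dX y| <= L * S.
      have := lX (W1 y) (X1 y) (Y1 y) (W y) (X y) (Y y); rewrite e1 e2 e3 f1 f2 f3 => h.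
      by apply: le_trans h (up _ LX0 _); rewrite /L; lra.
    have hY : `|dY y| <= L * S.
      have := lY (W1 y) (X1 y) (Y1 y) (W y) (X y) (Y y); rewrite e1 e2 e3 f1 f2 f3 => h.
      by apply: le_trans h (up _ LY0 _); rewrite /L; lra.
    have L0 : 0 <= L by rewrite !addr_ge0.
    have aux u v : `|v| <= L * S -> - (`|u| * (L * S)) <= u * v.
      move=> hv; have : `|u * v| <= `|u| * (L * S) by rewrite normrM ler_wpM2l.
      by rewrite ler_norml => /andP[].
    have gW := aux (W1 y - W y) _ hW; have gX := aux (X1 y - X y) _ hX.
    have gY := aux (Y1 y - Y y) _ hY.
    have S2 : S * S <= 3 * E y := sqr_sum3_le _ _ _.
    have S3 := ler_wpM2l L0 S2.
    have SE : `|W1 y - W y| * (L * S) + `|X1 y - X y| * (L * S) + `|Y1 y - Y y| * (L * S) =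
      L * (S * S) by rewrite /S; ring.
    have -> : - (6 * L) * E y = - (2 * (L * (3 * E y))) by ring.
    have -> : E' y = 2 * ((W1 y - W y) * dW y + (X1 y - X y) * dX y + (Y1 y - Y y) * dY y).
      by rewrite /E'; ring.
    rewrite -mulrN ler_pM2l //; lra.
  - by rewrite /E W00 X00 Y00 !subrr expr0n /= !addr0.
move=> y yJ; have := EE y yJ; rewrite /E => Ey.
have h1 := sqr_ge0 (W1 y - W y); have h2 := sqr_ge0 (X1 y - X y).
have h3 := sqr_ge0 (Y1 y - Y y).
have z (u : R) : u ^+ 2 = 0 -> u = 0 by move=> /eqP; rewrite sqrf_eq0 => /eqP.
by split; apply/eqP; rewrite -subr_eq0; apply/eqP; apply: z; lra.
Unshelve. all: by end_near. Qed.

End Uniqueness.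

(** * The round metric in stereographic coordinates *)

Section PartialDerivatives.
Context {R : realType} {m : nat}.
Implicit Types (f g : 'rV[R]_m -> R) (p : 'rV[R]_m) (i j k : 'I_m).

Lemma is_derive_partial i f p l :
  is_derive p (delta_mx 0 i : 'rV[R]_m) f l -> partial i f p = l.
Proof. by case. Qed.

Lemma is_derive_coord k p i :
  is_derive p (delta_mx 0 i : 'rV[R]_m) (fun q : 'rV[R]_m => q 0 k) ((i == k)%:R : R).
Proof.
apply/is_derive_lineP.
have -> : (fun h : R => (h *: delta_mx 0 i + p) 0 k) =
    (fun h : R => h * (i == k)%:R + p 0 k).
  by apply/funext => h; rewrite !mxE eqxx /= eq_sym.
have := is_derive_add (is_derive_mul (is_derive_id (0 : R) (1 : R))
  (is_derive_cst ((i == k)%:R : R) (0 : R) (1 : R))) (is_derive_cst (p 0 k) (0 : R) (1 : R)).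
by congr is_derive; rewrite /cst /=; ring.
Qed.

Lemma is_derive_bigsum (I : Type) (r : seq I) (P : pred I) (F : I -> 'rV[R]_m -> R)
    (dF : I -> R) p v : (forall k : I, P k -> is_derive p v (F k) (dF k)) ->
  is_derive p v (fun q => \sum_(k <- r | P k) F k q) (\sum_(k <- r | P k) dF k).
Proof.
move=> H; elim: r => [|k r IH].
  rewrite big_nil (_ : (fun q => _) = cst 0); first exact: is_derive_cst.
  by apply/funext => q; rewrite big_nil.
rewrite big_cons (_ : (fun q => _) = (fun q =>
    if P k then F k q + \sum_(k <- r | P k) F k q else \sum_(k <- r | P k) F k q)).
  by case: ifP => Pk; [apply: is_derive_add => //; exact: H|].
by apply/funext => q; rewrite big_cons.
Qed.

End PartialDerivatives.

Section Stereographic.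
Context {R : realType} {n : nat}.
Implicit Types (u v : 'rV[R]_n) (i j k : 'I_n).

(** Ratio of the lengths of the spherical metric and the flat one in the
    stereographic chart. *)
Definition conformal u : R := 2 / (1 + \sum_(k < n) u 0 k ^+ 2).

Lemma sumsq_ge0 u : 0 <= \sum_(k < n) u 0 k ^+ 2.
Proof. by apply: sumr_ge0 => k _; exact: sqr_ge0. Qed.

Lemma conformal_gt0 u : 0 < conformal u.
Proof. by rewrite divr_gt0 // ltr_pwDl // sumsq_ge0. Qed.

Lemma sumsq_conformal u : conformal u * \sum_(k < n) u 0 k ^+ 2 = 2 - conformal u.
Proof.
have := sumsq_ge0 u; rewrite /conformal; set r := \sum_(_ < _) _ => r0.
by field; rewrite gt_eqF // ltr_pwDl.
Qed.

Lemma is_derive_conformal u i :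
  is_derive u (delta_mx 0 i : 'rV[R]_n) conformal (- conformal u ^+ 2 * u 0 i).
Proof.
have := sumsq_ge0 u; rewrite /conformal; set r := \sum_(_ < _) _ => r0.
have r1 : 1 + r != 0 by rewrite gt_eqF // ltr_pwDl.
pose F (v : 'rV[R]_n) := 1 + \sum_(k < n) v 0 k ^+ 2.
have dr : is_derive u (delta_mx 0 i : 'rV[R]_n) F (0 + \sum_(k < n) 2 * u 0 k * (i == k)%:R).
  apply: is_derive_add; apply: is_derive_bigsum => k _.
  by apply: is_derive_sqr; exact: is_derive_coord.
have := is_derive_mul (is_derive_cst (2 : R) u (delta_mx 0 i : 'rV[R]_n))
  (is_derive_inv (f := F) r1 dr).
rewrite (bigD1 i) //= eqxx big1 => [|k /negbTE ki]; last by rewrite eq_sym ki mulr0.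
by congr is_derive; rewrite /cst /= /F -/r; field.
Qed.

(** Stereographic projection is conformal. *)
Lemma sphere_metricE (s : bool) u : sphere_metric s u = (conformal u ^+ 2)%:M.
Proof.
apply/matrixP => i j; rewrite !mxE.
have dl (a k : 'I_n) : partial a (fun v => stereographic s v 0 (lshift 1 k)) u =
    conformal u * (a == k)%:R - conformal u ^+ 2 * u 0 a * u 0 k.
  apply: is_derive_partial.
  rewrite (_ : (fun v => _) = (fun v => conformal v * v 0 k)); last first.
    by apply/funext => v; rewrite /stereographic row_mxEl mxE.
  have := is_derive_mul (is_derive_conformal u a) (is_derive_coord k u a).
  by congr is_derive; ring.
have dr (a : 'I_n) : partial a (fun v => stereographic s v 0 (rshift n ord0)) u =
    (-1) ^+ s * (conformal u ^+ 2 * u 0 a).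
  apply: is_derive_partial.
  rewrite (_ : (fun v => _) = (fun v => (-1) ^+ s * (1 - conformal v))); last first.
    apply/funext => v; rewrite /stereographic row_mxEr mxE eqxx mulr1n /conformal.
    congr (_ * _); have := sumsq_ge0 v; set r := \sum_(_ < _) _ => r0.
    by field; rewrite gt_eqF // ltr_pwDl.
  have := is_derive_mul (is_derive_cst ((-1) ^+ s : R) u (delta_mx 0 a : 'rV[R]_n))
    (is_derive_sub (is_derive_cst (1 : R) u (delta_mx 0 a : 'rV[R]_n)) (is_derive_conformal u a)).
  by congr is_derive; rewrite /cst /=; ring.
rewrite big_split_ord /= big_ord1.
under eq_bigr do rewrite !dl.
rewrite !dr.
have -> : (-1) ^+ s * (conformal u ^+ 2 * u 0 i) * ((-1) ^+ s * (conformal u ^+ 2 * u 0 j))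
    = conformal u ^+ 4 * u 0 i * u 0 j.
  by case: (s); rewrite ?expr1 ?expr0; ring.
set c := conformal u.
have -> : \sum_(k < n) (c * (i == k)%:R - c ^+ 2 * u 0 i * u 0 k) *
      (c * (j == k)%:R - c ^+ 2 * u 0 j * u 0 k) =
    \sum_(k < n) (c ^+ 2 * ((i == k)%:R * (j == k)%:R) - c ^+ 3 * u 0 j * (u 0 k * (i == k)%:R)
      - c ^+ 3 * u 0 i * (u 0 k * (j == k)%:R) + c ^+ 4 * u 0 i * u 0 j * u 0 k ^+ 2).
  by apply: eq_bigr => k _; ring.
have pick (a : 'I_n) (F : 'I_n -> R) : \sum_(k < n) F k * (a == k)%:R = F a.
  rewrite (bigD1 a) //= eqxx mulr1 big1 ?addr0 // => k /negbTE ka.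
  by rewrite eq_sym ka mulr0.
rewrite big_split /= !sumrB -!mulr_sumr !pick.
have := sumsq_conformal u; rewrite -/c => cr.
have -> : c ^+ 4 * u 0 i * u 0 j * \sum_(k < n) u 0 k ^+ 2 =
  c ^+ 3 * u 0 i * u 0 j * (c * \sum_(k < n) u 0 k ^+ 2) by ring.
rewrite cr -mulr_natr; ring.
Qed.

End Stereographic.

(** * Curvature of a warped product over an interval *)

Section FibreIndices.
Context {R : realType} {n : nat}.
Implicit Types (i j k l : 'I_(1 + n)) (b B : 'I_(1 + n) -> R).

Definition base_idx : 'I_(1 + n) := lshift n ord0.

(** Indicator of the sphere directions among the 1 + n coordinates.  Together
    with [fibre_delta] it lets one formula cover the base-base, base-fibre and
    fibre-fibre blocks of each tensor. *)
Definition fibre_ind i : R := (i != base_idx)%:R.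

(** Kronecker symbol restricted to the sphere directions. *)
Definition fibre_delta i j : R := (i == j)%:R * fibre_ind i.

Lemma fibre_indP i : (i = base_idx /\ fibre_ind i = 0) \/ (i != base_idx /\ fibre_ind i = 1).
Proof. by rewrite /fibre_ind; case: eqVneq => [->|]; [left|right]. Qed.

Lemma fibre_ind_base : fibre_ind base_idx = 0. Proof. by rewrite /fibre_ind eqxx. Qed.

Lemma fibre_ind_idem i : fibre_ind i * fibre_ind i = fibre_ind i.
Proof. by case: (fibre_indP i) => -[_ ->]; ring. Qed.

Lemma fibre_ind_rshift (k : 'I_n) : fibre_ind (rshift 1 k) = 1.
Proof. by rewrite /fibre_ind. Qed.

Lemma fibre_deltaC i j : fibre_delta i j = fibre_delta j i.
Proof. by rewrite /fibre_delta eq_sym; case: eqVneq => [->//|]; rewrite !mul0r. Qed.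

Lemma fibre_delta_diag i : fibre_delta i i = fibre_ind i.
Proof. by rewrite /fibre_delta eqxx mul1r. Qed.

Lemma fibre_delta_base i : fibre_delta i base_idx = 0.
Proof. by rewrite fibre_deltaC /fibre_delta fibre_ind_base mulr0. Qed.

Lemma fibre_ind_delta i j : fibre_ind i * fibre_delta i j = fibre_delta i j.
Proof. by rewrite /fibre_delta mulrCA fibre_ind_idem. Qed.

Lemma sum_idx (F : 'I_(1 + n) -> R) :
  \sum_k F k = F base_idx + \sum_(k < n) F (rshift 1 k).
Proof. by rewrite big_split_ord /= big_ord1. Qed.

Lemma sum_fibre_ind : \sum_k fibre_ind k = n%:R.
Proof.
rewrite sum_idx fibre_ind_base add0r (eq_bigr (fun=> 1)) => [|k _]; last exact: fibre_ind_rshift.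
by rewrite sumr_const card_ord.
Qed.

Lemma sum_fibre_delta i (F : 'I_(1 + n) -> R) : \sum_k fibre_delta i k * F k = fibre_ind i * F i.
Proof.
rewrite (bigD1 i) //= fibre_delta_diag big1 ?addr0 // => k ki.
by rewrite /fibre_delta eq_sym (negbTE ki) !mul0r.
Qed.

(** Christoffel symbol Gamma^k_ij of dx^2 + G |du|^2, where b i is half the
    logarithmic derivative of G in direction i, and B k is b k for a sphere
    direction and G b k for the base direction. *)
Definition warped_gamma b B k i j : R :=
  fibre_delta j k * b i + fibre_delta i k * b j - fibre_delta i j * B k.

Section Contraction.
Variables (b B : 'I_(1 + n) -> R).
Hypothesis bB : forall i, fibre_ind i * B i = fibre_ind i * b i.
Let beta := \sum_l b l * B l.

Let warped_gamma_trace l : \sum_k warped_gamma b B k k l = n%:R * b l.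
Proof.
have -> : \sum_k warped_gamma b B k k l = \sum_k fibre_delta l k * b k + (\sum_k fibre_ind k) * b l
   - \sum_k fibre_delta l k * B k.
  rewrite mulr_suml -big_split /= -sumrB; apply: eq_bigr => k _.
  by rewrite /warped_gamma fibre_delta_diag (fibre_deltaC k l).
by rewrite !sum_fibre_delta sum_fibre_ind bB; ring.
Qed.

Let warped_gamma_lower k j : \sum_l B l * warped_gamma b B k j l =
  fibre_ind k * B k * b j + fibre_delta j k * beta - fibre_ind j * B j * B k.
Proof.
have -> : \sum_l B l * warped_gamma b B k j l = \sum_l fibre_delta k l * (B l * b j) +
   fibre_delta j k * beta - \sum_l fibre_delta j l * (B l * B k).
  rewrite mulr_sumr -big_split /= -sumrB; apply: eq_bigr => l _.
  by rewrite /warped_gamma (fibre_deltaC l k); ring.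
by rewrite !sum_fibre_delta; ring.
Qed.

Let warped_gamma_inner k i j : \sum_l warped_gamma b B k j l * warped_gamma b B l i k =
  fibre_ind k * (b i * warped_gamma b B k j k) + fibre_ind i * (b k * warped_gamma b B k j i) -
  fibre_delta i k * (fibre_ind k * B k * b j + fibre_delta j k * beta - fibre_ind j * B j * B k).
Proof.
rewrite -warped_gamma_lower mulr_sumr.
rewrite -(sum_fibre_delta k (fun l => b i * warped_gamma b B k j l)).
rewrite -(sum_fibre_delta i (fun l => b k * warped_gamma b B k j l)).
rewrite -big_split /= -sumrB; apply: eq_bigr => l _.
by rewrite {2}/warped_gamma; ring.
Qed.

(** The quadratic part of the Ricci tensor.  Every term carries a Kronecker
    symbol, which collapses one of the two sums, and b and B may be exchanged
    in sphere directions. *)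
Lemma warped_gamma_contraction i j :
  \sum_k \sum_l (warped_gamma b B k k l * warped_gamma b B l i j
                    - warped_gamma b B k j l * warped_gamma b B l i k) =
  (n%:R * (fibre_ind i + fibre_ind j - 1) - 2 * fibre_ind i * fibre_ind j) * (b i * b j)
  + fibre_delta i j * ((2 - n%:R) * beta).
Proof.
have -> : \sum_k \sum_l (warped_gamma b B k k l * warped_gamma b B l i j
                    - warped_gamma b B k j l * warped_gamma b B l i k) =
  \sum_l n%:R * b l * warped_gamma b B l i j - \sum_k \sum_l warped_gamma b B k j l * warped_gamma b B l i k.
  rewrite -(eq_bigr _ (fun l _ => congr1 (fun x => x * warped_gamma b B l i j) (warped_gamma_trace l))).
  under [X in _ = X - _]eq_bigr do rewrite mulr_suml.
  rewrite [X in _ = X - _]exchange_big -sumrB.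
  by apply: eq_bigr => k _; rewrite sumrB.
have -> : \sum_l n%:R * b l * warped_gamma b B l i j =
    n%:R * ((fibre_ind i + fibre_ind j) * (b i * b j) - fibre_delta i j * beta).
  have -> : \sum_l n%:R * b l * warped_gamma b B l i j = n%:R * (\sum_l fibre_delta j l * (b l * b i) +
     \sum_l fibre_delta i l * (b l * b j) - fibre_delta i j * beta).
    rewrite [X in _ - X]mulr_sumr -big_split /= -sumrB mulr_sumr.
    by apply: eq_bigr => l _; rewrite /warped_gamma; ring.
  by rewrite !sum_fibre_delta; ring.
have -> : \sum_k \sum_l warped_gamma b B k j l * warped_gamma b B l i k =
    n%:R * (b i * b j) + 2 * fibre_ind i * fibre_ind j * (b i * b j) - 2 * fibre_delta i j * beta.
  under eq_bigr do rewrite warped_gamma_inner.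
  rewrite sumrB big_split /=.
  have -> : \sum_k fibre_ind k * (b i * warped_gamma b B k j k) = n%:R * (b i * b j).
    rewrite -sum_fibre_ind mulr_suml; apply: eq_bigr => k _.
    have bBk : fibre_ind k * (b k - B k) = 0 by rewrite mulrBr bB subrr.
    have -> : fibre_ind k * (b i * warped_gamma b B k j k) =
      fibre_ind k * fibre_ind k * (b i * b j) + b i * fibre_delta j k * (fibre_ind k * (b k - B k)).
      by rewrite /warped_gamma fibre_delta_diag; ring.
    by rewrite bBk mulr0 addr0 fibre_ind_idem.
  have -> : \sum_k fibre_ind i * (b k * warped_gamma b B k j i) =
     fibre_ind i * ((fibre_ind i + fibre_ind j) * (b i * b j) - fibre_delta i j * beta).
    rewrite -mulr_sumr; congr (_ * _).
    have -> : \sum_k b k * warped_gamma b B k j i = \sum_k fibre_delta i k * (b k * b j) +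
       \sum_k fibre_delta j k * (b k * b i) - fibre_delta i j * beta.
      rewrite [X in _ - X]mulr_sumr -big_split /= -sumrB.
      by apply: eq_bigr => l _; rewrite /warped_gamma (fibre_deltaC i j); ring.
    by rewrite !sum_fibre_delta; ring.
  rewrite sum_fibre_delta (fibre_deltaC j i).
  have -> : fibre_ind i * ((fibre_ind i + fibre_ind j) * (b i * b j) - fibre_delta i j * beta) =
     (fibre_ind i * fibre_ind i + fibre_ind i * fibre_ind j) * (b i * b j) - (fibre_ind i * fibre_delta i j) * beta by ring.
  have -> : fibre_ind i * (fibre_ind i * B i * b j + fibre_delta i j * beta - fibre_ind j * B j * B i) =
     (fibre_ind i * fibre_ind i) * b j * B i + (fibre_ind i * fibre_delta i j) * beta - (fibre_ind i * B i) * (fibre_ind j * B j).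
    by ring.
  rewrite fibre_ind_delta fibre_ind_idem !bB.
  have -> : fibre_ind i * b j * B i = (fibre_ind i * B i) * b j by ring.
  by rewrite bB; ring.
by ring.
Qed.

End Contraction.

End FibreIndices.

Section WarpedGeometry.
Context {R : realType} {n : nat}.
Variables (psi h h' phi om om' : R -> R) (lam delta : R).
Hypothesis psi_gt0 : forall x, 0 < x < delta -> 0 < psi x.
Hypothesis dpsi : forall x, 0 < x < delta -> is_derive x (1 : R) psi (psi x * h x).
Hypothesis dh : forall x, 0 < x < delta -> is_derive x (1 : R) h (h' x).
Hypothesis dphi : forall x, 0 < x < delta -> is_derive x (1 : R) phi (om x).
Hypothesis dom : forall x, 0 < x < delta -> is_derive x (1 : R) om (om' x).
Hypothesis soliton_base : forall x, 0 < x < delta ->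
  om' x = n%:R * (h' x + h x ^+ 2) - lam.
Hypothesis soliton_fibre : forall x, 0 < x < delta ->
  psi x ^+ 2 * (h' x + n%:R * h x ^+ 2 - h x * om x - lam) = n%:R - 1.

Local Notation fib := (@fibre_ind R n).
Local Notation fibd := (@fibre_delta R n).
Local Notation idx := 'I_(1 + n).
Local Notation pt := 'rV[R]_(1 + n).
Local Notation dir j := (delta_mx 0 j : pt).
Implicit Types (p q : pt) (i j k l : idx) (s : bool).

Let cf p : R := conformal (rsubmx p).
Let G p : R := psi (xcoord p) ^+ 2 * cf p ^+ 2.

(** b and B are the arguments of [warped_gamma] for this metric, whose sphere
    entries are G; db i j and dB i j are the derivatives of b i and B i in
    direction j. *)
Let b i p : R := (1 - fib i) * h (xcoord p) - fib i * (cf p * p 0 i).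
Let B i p : R := (fib i + (1 - fib i) * G p) * b i p.
Let db i j p : R := (1 - fib i) * ((1 - fib j) * h' (xcoord p))
  + fib i * (fib j * (cf p ^+ 2 * p 0 j * p 0 i) - cf p * (j == i)%:R).
Let dB i j p : R := (1 - fib i) * (2 * G p * b j p * b i p)
  + (fib i + (1 - fib i) * G p) * db i j p.

Let dom_p p := 0 < xcoord p < delta.

Let is_derive_xcoord p j : is_derive p (dir j) xcoord (1 - fib j).
Proof.
rewrite (_ : xcoord = fun q : pt => q 0 (base_idx : idx)); last first.
  by apply/funext => q; rewrite /xcoord mxE.
have := is_derive_coord (base_idx : idx) p j; congr is_derive.
by rewrite /fib; case: eqP => _ /=; ring.
Qed.

Let is_derive_cf p j : is_derive p (dir j) cf (- (fib j * (cf p ^+ 2 * p 0 j))).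
Proof.
apply/is_derive_lineP; rewrite /cf.
have E a (t : R) : rsubmx (t *: dir a + p) = t *: rsubmx (dir a) + rsubmx p.
  by apply/rowP => k; rewrite !mxE.
case: (split_ordP j) => j' ->.
  have -> : fib (lshift n j') = 0 by rewrite (ord1 j') fibre_ind_base.
  rewrite mul0r oppr0 (_ : (fun t => _) = cst (conformal (rsubmx p))).
    exact: is_derive_cst.
  apply/funext => t; rewrite E (_ : rsubmx _ = 0) ?scaler0 ?add0r //.
  by apply/rowP => k; rewrite !mxE eqxx /= eq_rlshift.
rewrite fibre_ind_rshift mul1r.
have /is_derive_lineP := is_derive_conformal (rsubmx p) j'.
rewrite mxE mulNr (_ : (fun t => _) = (fun t => conformal (rsubmx (t *: dir (rshift 1 j') + p)))) //.
apply/funext => t; rewrite E; congr (conformal (_ *: _ + _)).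
by apply/rowP => k; rewrite !mxE eqxx /= eq_rshift.
Qed.

Let is_derive_G p j : dom_p p -> is_derive p (dir j) G (2 * G p * b j p).
Proof.
move=> px.
have := is_derive_mul (is_derive_sqr (is_derive_comp (dpsi px) (is_derive_xcoord p j)))
  (is_derive_sqr (is_derive_cf p j)).
by congr is_derive; rewrite /G /b; ring.
Qed.

Let is_derive_b i p j : dom_p p -> is_derive p (dir j) (b i) (db i j p).
Proof.
move=> px.
have := is_derive_sub
  (is_derive_mul (is_derive_cst (1 - fib i) p (dir j))
     (is_derive_comp (dh px) (is_derive_xcoord p j)))
  (is_derive_mul (is_derive_cst (fib i) p (dir j))
     (is_derive_mul (is_derive_cf p j) (is_derive_coord i p j))).
by congr is_derive; rewrite /db /cst /=; ring.
Qed.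

Let is_derive_B i p j : dom_p p -> is_derive p (dir j) (B i) (dB i j p).
Proof.
move=> px.
have := is_derive_mul (is_derive_add (is_derive_cst (fib i) p (dir j))
  (is_derive_mul (is_derive_cst (1 - fib i) p (dir j)) (is_derive_G j px)))
  (is_derive_b i j px).
by congr is_derive; rewrite /dB /cst /=; ring.
Qed.

Let G_gt0 p : dom_p p -> 0 < G p.
Proof. by move=> px; rewrite mulr_gt0 // exprn_gt0 ?psi_gt0 ?conformal_gt0. Qed.

Let metric s p := warped_metric (n := n) psi s p.

Let metric_block s p : metric s p = block_mx 1%:M 0 0 (G p)%:M.
Proof. by rewrite /metric /warped_metric sphere_metricE scale_scalar_mx. Qed.

Let block_entry (a : R) i j :
  (block_mx 1%:M 0 0 a%:M : 'M[R]_(1 + n)) i j = (i == j)%:R * (fib i * a + (1 - fib i)).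
Proof.
case: (split_ordP i) => i' ->; case: (split_ordP j) => j' ->.
- by rewrite block_mxEul mxE (ord1 i') (ord1 j') eqxx fibre_ind_base; ring.
- by rewrite block_mxEur mxE eq_lrshift mul0r.
- by rewrite block_mxEdl mxE eq_rlshift mul0r.
- rewrite block_mxEdr mxE eq_rshift fibre_ind_rshift -mulr_natr; ring.
Qed.

Let metric_entry s p i j : metric s p i j = fibd i j * G p + (1 - fib i) * (i == j)%:R.
Proof. by rewrite metric_block block_entry /fibre_delta; case: eqVneq => [->|_]; ring. Qed.

Let invmx_entry s p i j : dom_p p ->
  invmx (metric s p) i j = (i == j)%:R * (fib i / G p + (1 - fib i)).
Proof.
move=> px; rewrite -block_entry.
suff -> : invmx (metric s p) = block_mx 1%:M 0 0 (G p)^-1%:M by [].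
have AB : metric s p *m block_mx 1%:M 0 0 (G p)^-1%:M = 1%:M.
  rewrite metric_block mulmx_block !mul0mx !mulmx0 !addr0 !add0r mul1mx.
  by rewrite -scalar_mxM mulfV ?gt_eqF ?G_gt0 // -scalar_mx_block.
have [uA _] := mulmx1_unit AB.
by rewrite -[RHS]mul1mx -(mulVmx uA) -mulmxA AB mulmx1.
Qed.

Let christoffelE s p k i j : dom_p p ->
  christoffel (metric s) k i j p = warped_gamma (b^~ p) (B^~ p) k i j.
Proof.
move=> px; rewrite /christoffel.
have D a c d : partial a (fun q => metric s q c d) p = fibd c d * (2 * G p * b a p).
  apply: is_derive_partial.
  rewrite (_ : (fun q => _) = (fun q => fibd c d * G q + (1 - fib c) * (c == d)%:R)); last first.
    by apply/funext => q; rewrite metric_entry.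
  have := is_derive_add (is_derive_mul (is_derive_cst (fibd c d) p (dir a)) (is_derive_G a px))
    (is_derive_cst ((1 - fib c) * (c == d)%:R) p (dir a)).
  by congr is_derive; rewrite /cst /=; ring.
under eq_bigr do rewrite !D invmx_entry //.
rewrite (bigD1 k) //= eqxx mul1r big1 ?addr0; last first.
  by move=> l /negbTE lk; rewrite eq_sym lk !mul0r.
rewrite /warped_gamma /B.
have G0 : G p != 0 by rewrite gt_eqF // G_gt0.
have [[-> e]|[_ e]] := @fibre_indP R n k; rewrite e; last by field.
by rewrite !fibre_delta_base; field.
Qed.

Let near_dom p : dom_p p -> \forall q \near p, dom_p q.
Proof.
move=> /andP[x0 xd].
have cx : {for p, continuous (xcoord : pt -> R)}.
  rewrite (_ : xcoord = fun q : pt => q 0 (base_idx : idx)); last first.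
    by apply/funext => q; rewrite /xcoord mxE.
  exact: coord_continuous.
have : \forall x \near xcoord p, 0 < x < delta.
  near=> x; apply/andP; split; near: x; [exact: lt_nbhsr|exact: lt_nbhsl].
exact: cx.
Unshelve. all: by end_near. Qed.

(** The closed form of the Christoffel symbols holds on an open set, so it may
    be differentiated. *)
Let partial_christoffel s p a k i j : dom_p p ->
  partial a (christoffel (metric s) k i j) p =
  fibd j k * db i a p + fibd i k * db j a p - fibd i j * dB k a p.
Proof.
move=> px; rewrite /partial (@near_eq_derive _ _ _ _ (fun q => warped_gamma (b^~ q) (B^~ q) k i j)).
  apply: is_derive_partial.
  have := is_derive_sub (is_derive_add
    (is_derive_mul (is_derive_cst (fibd j k) p (dir a)) (is_derive_b i a px))
    (is_derive_mul (is_derive_cst (fibd i k) p (dir a)) (is_derive_b j a px)))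
    (is_derive_mul (is_derive_cst (fibd i j) p (dir a)) (is_derive_B k a px)).
  by congr is_derive; rewrite /cst /=; ring.
near=> q; apply: christoffelE; near: q; exact: near_dom.
Unshelve. all: by end_near. Qed.

Let r2 p := \sum_k fib k * p 0 k ^+ 2.

Let cf_r2 p : cf p * r2 p = 2 - cf p.
Proof.
rewrite -[RHS]sumsq_conformal /r2 sum_idx fibre_ind_base mul0r add0r; congr (_ * _).
by apply: eq_bigr => k _; rewrite fibre_ind_rshift mul1r mxE.
Qed.

Let r2E p : r2 p = \sum_(k < n) p 0 (rshift 1 k) ^+ 2.
Proof.
rewrite /r2 sum_idx fibre_ind_base mul0r add0r; apply: eq_bigr => k _.
by rewrite fibre_ind_rshift mul1r.
Qed.

Let sum_bB p : \sum_k b k p * B k p = G p * h (xcoord p) ^+ 2 + cf p ^+ 2 * r2 p.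
Proof.
rewrite r2E sum_idx [X in _ = _ + X]mulr_sumr; congr (_ + _).
  by rewrite /B /b fibre_ind_base; ring.
by apply: eq_bigr => k _; rewrite /B /b fibre_ind_rshift; ring.
Qed.

Let sum_dB p : \sum_k dB k k p =
  2 * G p * h (xcoord p) ^+ 2 + G p * h' (xcoord p) + (cf p ^+ 2 * r2 p - cf p * n%:R).
Proof.
rewrite r2E sum_idx; congr (_ + _).
  by rewrite /dB /db /b fibre_ind_base; ring.
have -> : cf p * n%:R = \sum_(k < n) cf p by rewrite sumr_const card_ord mulr_natr.
rewrite mulr_sumr -sumrB; apply: eq_bigr => k _.
by rewrite /dB /db /b fibre_ind_rshift eqxx /=; ring.
Qed.

Let ricciE s p i j : dom_p p -> ricci (metric s) p i j =
  fib j * db i j p + fib i * db j i p - fibd i j * \sum_k dB k k p - n%:R * db i j p +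
  ((n%:R * (fib i + fib j - 1) - 2 * fib i * fib j) * (b i p * b j p)
  + fibd i j * ((2 - n%:R) * \sum_k b k p * B k p)).
Proof.
move=> px; rewrite mxE; congr (_ + _).
  have -> : \sum_k (partial k (christoffel (metric s) k i j) p -
                    partial j (christoffel (metric s) k i k) p) =
    \sum_k fibd j k * db i k p + \sum_k fibd i k * db j k p - fibd i j * \sum_k dB k k p
    - (\sum_k fib k) * db i j p - \sum_k fibd i k * (db k j p - dB k j p).
    rewrite mulr_sumr mulr_suml -big_split /= -!sumrB; apply: eq_bigr => k _.
    by rewrite !partial_christoffel // fibre_delta_diag; ring.
  rewrite !sum_fibre_delta sum_fibre_ind.
  have -> : fib i * (db i j p - dB i j p) = 0.
    by rewrite /dB; case: (@fibre_indP R n i) => -[_ ->]; ring.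
  by rewrite subr0.
rewrite -warped_gamma_contraction; last first.
  by move=> k; rewrite /B; case: (@fibre_indP R n k) => -[_ ->]; ring.
by apply: eq_bigr => k _; apply: eq_bigr => l _; rewrite !christoffelE.
Qed.

Let hessianE s p i j : dom_p p -> hessian (metric s) (phi \o xcoord) p i j =
  (1 - fib i) * (1 - fib j) * om' (xcoord p) + fibd i j * (G p * h (xcoord p) * om (xcoord p)).
Proof.
move=> px; rewrite mxE.
have d1 k q : dom_p q -> partial k (phi \o xcoord) q = om (xcoord q) * (1 - fib k).
  by move=> qx; apply: is_derive_partial; exact: is_derive_comp (dphi qx) (is_derive_xcoord q k).
have -> : partial i (partial j (phi \o xcoord)) p = (1 - fib i) * (1 - fib j) * om' (xcoord p).
  rewrite /partial (@near_eq_derive _ _ _ _ (fun q => om (xcoord q) * (1 - fib j))).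
    apply: is_derive_partial.
    have := is_derive_mul (is_derive_comp (dom px) (is_derive_xcoord p i))
      (is_derive_cst (1 - fib j) p (dir i)).
    by congr is_derive; rewrite /cst /=; ring.
  by near=> q; apply: d1; near: q; exact: near_dom.
rewrite (bigD1 base_idx) //= big1 => [|k kb]; last first.
  by rewrite d1 // /fibre_ind kb /= subrr !mulr0.
rewrite addr0 d1 // christoffelE // /warped_gamma /B /b fibre_ind_base.
by rewrite !fibre_delta_base; ring.
Unshelve. all: by end_near. Qed.

(** With h = psi' / psi, the two hypotheses are the base-base and the
    fibre-fibre components of the tensor equation; the mixed components and the
    fibre components off the diagonal vanish identically. *)
Lemma warped_soliton : warped_gradient_soliton n lam delta psi phi.
Proof.
move=> s p px; rewrite /gradient_soliton_at.
apply/matrixP => i j; rewrite mxE [X in X + _]mxE [X in _ + X]mxE [RHS]mxE.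
rewrite -/(metric s) ricciE // hessianE // -/(metric s p) metric_entry.
rewrite sum_bB sum_dB; set x := xcoord p.
have rb := soliton_base px; have rf := soliton_fibre px; rewrite -/x in rb rf.
have [[-> ei]|[ib ei]] := @fibre_indP R n i; have [[-> ej]|[jb ej]] := @fibre_indP R n j.
- rewrite /db /b /fibre_delta fibre_ind_base eqxx rb -/x /=; ring.
- rewrite /db /b /fibre_delta fibre_ind_base ej (negbTE jb) eq_sym (negbTE jb) /=; ring.
- rewrite /db /b /fibre_delta fibre_ind_base ei (negbTE ib) eq_sym (negbTE ib) /=; ring.
have [->|ij] := eqVneq i j; last first.
  rewrite /db /b /fibre_delta ei ej (negbTE ij) eq_sym (negbTE ij) /=; ring.
rewrite /db /b fibre_delta_diag ej eqxx -/x /=.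
have cr := cf_r2 p; have -> : cf p ^+ 2 * r2 p = cf p * (2 - cf p) by rewrite -cr; ring.
have -> : lam * (1 * G p + (1 - 1) * 1%:R) = G p * lam by ring.
(* The fibre equation, multiplied by the square of the conformal factor. *)
have GE : G p * (h' x + n%:R * h x ^+ 2 - h x * om x - lam) = (n%:R - 1) * cf p ^+ 2.
  by rewrite -rf /G -/x; ring.
transitivity ((n%:R - 1) * cf p ^+ 2 - G p * (h' x + n%:R * h x ^+ 2 - h x * om x - lam)).
  by ring.
by rewrite GE subrr.
Qed.

End WarpedGeometry.

(** * The arclength parameter *)

Section AtMinusInfinity.
Context {R : realType}.
Implicit Types (f g : R -> R) (x y t : R).

Lemma expRM_cvgNy (c : R) : 0 < c -> expR (c * y) @[y --> -oo] --> (0 : R).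
Proof.
move=> c0; apply/cvgrPdist_le => e e0.
have le0 : \forall y \near -oo, y <= ln e / c by exact: nbhs_ninfty_le (num_real _).
near=> y; rewrite sub0r normrN ger0_norm ?expR_ge0 //.
rewrite -(lnK (e0 : e \is Num.pos)) ler_expR mulrC -ler_pdivlMr //.
Unshelve. all: by end_near. Qed.

Lemma exp_dominated_cvgNy f (l B c : R) : 0 < c ->
  (forall t, t <= 0 -> `|f t - l| <= B * expR (c * t)) -> f y @[y --> -oo] --> l.
Proof.
move=> c0 fB; apply/cvgrPdist_le => e e0.
have : B * expR (c * t) @[t --> -oo] --> B * 0.
  by apply: cvgMr; exact: expRM_cvgNy.
rewrite mulr0 => /cvgrPdist_le/(_ e e0) He.
have y0 : \forall y \near -oo, y <= (0 : R) by exact: nbhs_ninfty_le (num_real _).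
near=> y; rewrite distrC; apply: le_trans (fB y _) _; first by near: y.
have : `|0 - B * expR (c * y)| <= e by near: y.
by rewrite sub0r normrN; apply: le_trans; exact: ler_norm.
Unshelve. all: by end_near. Qed.

(** D +- (B / c) exp(c t) are monotone in opposite directions and their
    difference tends to 0 at minus infinity, so that the limit is squeezed
    between them, with an explicit rate. *)
Lemma exp_derive_limit (D D' : R -> R) (B c : R) : 0 < c ->
  (forall t, t <= 0 -> is_derive (t : R) (1 : R) D (D' t)) ->
  (forall t, t <= 0 -> `|D' t| <= B * expR (c * t)) ->
  exists l, forall t, t <= 0 -> `|D t - l| <= B / c * expR (c * t).
Proof.
move=> c0 dD D'B.
pose g t := B / c * expR (c * t).
have dg (t : R) : is_derive t (1 : R) g (B * expR (c * t)).
  have := is_derive_mul (is_derive_cst (B / c) t (1 : R)) (is_derive_expRM c t).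
  by congr is_derive; rewrite /cst /=; field; rewrite gt_eqF.
have step (t r : R) : t <= r -> r <= 0 -> `|D r - D t| <= g r - g t.
  move=> tr r0; apply: (derive_dominated tr (f' := D') (g' := fun t => B * expR (c * t))) => //.
    by move=> s /andP[_ sr]; apply: dD; exact: le_trans sr r0.
  by move=> s /andP[_ sr]; apply: D'B; exact: le_trans sr r0.
have B0 : 0 <= B.
  have := le_trans (normr_ge0 _) (D'B 0 (lexx _)); by rewrite mulr0 expR0 mulr1.
have g0 t : 0 <= g t by rewrite mulr_ge0 ?expR_ge0 // divr_ge0 // ltW.
have lu (t r : R) : t <= 0 -> r <= 0 -> D t - g t <= D r + g r.
  move=> t0 r0; have := g0 t; have := g0 r; have [tr|rt] := leP t r.
    by have := step t r tr r0; rewrite ler_norml => /andP[]; lra.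
  by have := step r t (ltW rt) t0; rewrite ler_norml => /andP[]; lra.
pose S := [set D t - g t | t in [set t | t <= 0]].
have Ss : has_sup S.
  split; first by exists (D 0 - g 0), 0 => /=.
  by exists (D 0 + g 0) => _ [t /= t0 <-]; apply: lu.
exists (sup S) => t t0; rewrite ler_distl; apply/andP; split.
  rewrite lerBlDr; apply: ge_sup; first by case: Ss.
  by move=> _ [r /= r0 <-]; exact: lu.
by rewrite -lerBlDr; apply: (sup_upper_bound Ss); exists t.
Qed.

Lemma cvg_at_right_gt (T : Type) (F : set_system T) (f : T -> R) (a : R) : Filter F ->
  f t @[t --> F] --> a -> (\forall t \near F, a < f t) -> f t @[t --> F] --> a^'+.
Proof.
move=> FF fa fl A; rewrite /at_right /within /= => HA.
have H : \forall t \near F, a < f t -> A (f t) := fa _ HA.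
suff : \forall t \near F, A (f t) by [].
by near=> t; have af : a < f t; [near: t|apply: (near H t)].
Unshelve. all: by end_near. Qed.

End AtMinusInfinity.

Section Arclength.
Context {R : realType}.
Variables (W S : R -> R).
Hypothesis cW : continuous W.
Hypothesis W0 : forall y, y <= 0 -> 0 < W y.
Hypothesis dS : forall y, is_derive y (1 : R) S (W y).
Hypothesis S0 : S y @[y --> -oo] --> (0 : R).

Let mu := @lebesgue_measure R.

(** Reflecting the half-line turns this into the improper fundamental theorem on
    [-y, +oo[. *)
Lemma integral_NyE y : y <= 0 ->
  (\int[mu]_(z in `]-oo, y]) (W z)%:E = (S y)%:E)%E.
Proof.
move=> y0.
have := @ge0_integration_by_substitutionNy R W (- y); rewrite opprK => ->; last 2 first.
- exact: continuous_subspaceT.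
- by move=> x; rewrite in_itv/= => xy; apply/ltW/W0/ltW; exact: lt_le_trans xy y0.
have cWN : continuous (W \o -%R).
  by move=> x; apply: continuous_comp; [exact: opp_continuous|exact: cW].
have dSN (x : R) : is_derive x (1 : R) (fun x => - S (- x)) (W (- x)).
  have := is_deriveN (is_derive_comp (dS (- x)) (is_deriveNid x (1 : R))).
  by congr is_derive; rewrite mulrN1 opprK.
rewrite (@ge0_continuous_FTC2y R (W \o -%R) (fun x => - S (- x)) (- y) 0).
- by rewrite opprK EFinN oppeK add0e.
- by move=> x yx /=; apply/ltW/W0; lra.
- exact: continuous_subspaceT.
- rewrite -oppr0; apply: cvgN.
  by have /cvgNy_compNP := S0.
- by move=> x _; have [] := dSN x.
- have := is_derive_continuous (dSN (- y)) => cSN; exact: cvg_at_right_filter.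
- by move=> x _; rewrite derive1E; have [_ ->] := dSN x.
Qed.

Lemma arclengthE y : y <= 0 -> arclength W y = S y.
Proof. by move=> y0; rewrite /arclength /Rintegral integral_NyE. Qed.

Lemma integrable_Ny : mu.-integrable `]-oo, 0%R] (EFin \o W).
Proof.
apply/integrableP; split.
  apply/measurable_realfun.measurable_EFinP; apply: measurable_funS (measurable_realfun.continuous_measurable_fun cW) => //.
under eq_integral => x.
  rewrite inE/= in_itv/= => x0; rewrite ger0_norm ?(ltW (W0 x0)) //; over.
by rewrite integral_NyE // ltry.
Qed.

Lemma primitive_increasing y z : y < z -> z <= 0 -> S y < S z.
Proof.
move=> yz z0.
have [|c] := @MVT R S W y z yz (fun x _ => dS x).
  by apply: continuous_subspaceT => x; exact: is_derive_continuous (dS x).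
rewrite in_itv/= => /andP[_ cz] E; rewrite -subr_gt0 E mulr_gt0 ?subr_gt0 //.
by apply: W0; apply: ltW; exact: lt_le_trans cz z0.
Qed.

Lemma primitive_gt0 y : y <= 0 -> 0 < S y.
Proof.
move=> y0; have y1 : y - 1 < y by lra.
apply: le_lt_trans (primitive_increasing y1 y0).
apply: (cvgr_to_le S0).
have ty : \forall t \near -oo, t < y - 1 by exact: nbhs_ninfty_lt (num_real _).
near=> t; apply: ltW; apply: primitive_increasing; first by near: t.
by apply: ltW; exact: lt_le_trans y1 y0.
Unshelve. all: by end_near. Qed.

Lemma primitive_surj x : 0 < x -> x < S 0 -> exists2 y, y < 0 & S y = x.
Proof.
move=> x0 x1.
have Sx : \forall t \near -oo, S t <= x by move: (x) (x0); exact: cvgr_le.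
have t0 : \forall t \near -oo, t <= (0 : R) by exact: nbhs_ninfty_le (num_real _).
have [t [Stx tle0]] := @filter_ex _ _ _ _ (filterI Sx t0).
have cS : {within `[t, 0], continuous S}.
  by apply: continuous_subspaceT => z; exact: is_derive_continuous (dS z).
have SS : S t <= S 0 by exact: le_trans Stx (ltW x1).
have [|y] := @IVT R S t 0 x tle0 cS.
  by rewrite (min_idPl SS) (max_idPr SS) Stx ltW.
rewrite in_itv/= => /andP[_]; rewrite le_eqVlt => /orP[/eqP->|y0] Sy.
  by move: x1; rewrite -Sy ltxx.
by exists y.
Qed.

Lemma primitive_inj y z : y <= 0 -> z <= 0 -> S y = S z -> y = z.
Proof.
move=> y0 z0 E; have [yz|zy|//] := ltgtP y z.
  by have := primitive_increasing yz z0; rewrite E ltxx.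
by have := primitive_increasing zy y0; rewrite E ltxx.
Qed.

Lemma arclength_image : arclength W @` `]-oo, 0[ = `]0, S 0[%classic.
Proof.
apply/seteqP; split => [_ [y /= y0 <-]|x /=].
  move: y0; rewrite !in_itv/= => y0; rewrite arclengthE ?(ltW y0) //.
  by rewrite primitive_gt0 ?(ltW y0) //= primitive_increasing.
rewrite in_itv/= => /andP[x0 x1]; have [y y0 Sy] := primitive_surj x0 x1.
by exists y; rewrite /= ?in_itv //= arclengthE ?(ltW y0).
Qed.

Lemma arclength_cvg : arclength W y @[y --> -oo] --> (0 : R)^'+.
Proof.
have t0 : \forall t \near -oo, t <= (0 : R) by exact: nbhs_ninfty_le (num_real _).
apply: cvg_at_right_gt.
  apply: cvg_trans S0; apply: near_eq_cvg; near=> y.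
  by rewrite arclengthE //; near: y.
near=> y; have y0 : y <= 0 by near: y.
by rewrite arclengthE // primitive_gt0.
Unshelve. all: by end_near. Qed.

Lemma primitive_inverse : exists T : R -> R,
  [/\ forall y, y < 0 -> T (S y) = y,
      forall x, 0 < x < S 0 -> T x < 0 /\ S (T x) = x,
      forall x, 0 < x < S 0 -> is_derive x (1 : R) T (W (T x))^-1,
      T x @[x --> (0 : R)^'+] --> -oo &
      T x @[x --> (S 0)^'-] --> (0 : R)].
Proof.
have /choice[T HT] : forall x, exists y, 0 < x < S 0 -> y < 0 /\ S y = x.
  move=> x; have [/andP[x0 x1]|nx] := boolP (0 < x < S 0); last by exists 0.
  by have [y y0 Sy] := primitive_surj x0 x1; exists y.
have dom y : y < 0 -> 0 < S y < S 0.
  by move=> y0; rewrite primitive_gt0 ?(ltW y0) //= primitive_increasing.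
have TS y : y < 0 -> T (S y) = y.
  move=> y0; have [T0 ST] := HT _ (dom y y0).
  by apply: primitive_inj => //; exact: ltW.
have S00 : 0 < S 0 by apply: primitive_gt0.
exists T; split => //.
- move=> x xd; have [Tx0 STx] := HT x xd.
  rewrite -{1}STx; apply: is_derive_inverse.
  + by near=> y; apply: TS; near: y; exact: lt_nbhsl.
  + by near=> y; exact: is_derive_continuous (dS y).
  + by rewrite gt_eqF // W0 // ltW.
- apply/cvgrNyPlt => M; pose m := - (`|M| + 1).
  have m0 : m < 0 by rewrite oppr_lt0 ltr_wpDl.
  have mM : m <= M by have := ler_norm (- M); rewrite normrN /m; lra.
  have /andP[Sm0 Sm1] := dom m m0.
  near=> x; have x0 : 0 < x by [].
  have xm : x < S m by near: x; exact: nbhs_right_lt.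
  have [Tx0 STx] : T x < 0 /\ S (T x) = x.
    by apply: HT; rewrite x0 /=; exact: lt_trans xm Sm1.
  apply: lt_le_trans mM; rewrite ltNge; apply/negP => mT.
  move: mT; rewrite le_eqVlt => /orP[/eqP E|mT].
    by move: xm; rewrite E STx ltxx.
  have := primitive_increasing mT (ltW Tx0); rewrite STx => /lt_trans/(_ xm).
  by rewrite ltxx.
- apply/cvgrPdist_lt => e e0; have Ne : - e < 0 by lra.
  have /andP[Sm0 Sm1] := dom (- e) Ne.
  near=> x; have x1 : x < S 0 by [].
  have xm : S (- e) < x by near: x; exact: nbhs_left_gt.
  have [Tx0 STx] : T x < 0 /\ S (T x) = x.
    by apply: HT; rewrite x1 andbT; exact: lt_trans Sm0 xm.
  rewrite sub0r normrN ltr0_norm // ltrNl ltNge; apply/negP.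
  rewrite le_eqVlt => /orP[/eqP E|mT].
    by move: xm; rewrite -E STx ltxx.
  have := primitive_increasing mT (ltW Ne); rewrite STx => /lt_trans/(_ xm).
  by rewrite ltxx.
Unshelve. all: by end_near. Qed.

End Arclength.

(** * Smoothness in the arclength parameter *)

Section IteratedDerivatives.
Context {R : realType}.
Variables (C : (R -> R) -> Prop) (T : R -> R) (delta : R).
Hypothesis delta_gt0 : 0 < delta.
Hypothesis closed_derive : forall f, C f -> exists2 f', C f' &
  forall x, 0 < x < delta -> is_derive x (1 : R) (f \o T) (f' (T x)).
Hypothesis left_limit : forall f, C f -> cvg (f (T x) @[x --> delta^'-]).

Let near_itv x : 0 < x < delta -> \forall z \near x, 0 < z < delta.
Proof.
move=> /andP[x0 xd]; near=> z; apply/andP; split; near: z.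
  exact: lt_nbhsr.
exact: lt_nbhsl.
Unshelve. all: by end_near. Qed.

Let derive1n_class g f : C f -> (forall x, 0 < x < delta -> g x = f (T x)) ->
  forall k, exists2 fk, C fk &
    forall x, 0 < x < delta -> g^`(k) x = fk (T x) /\ derivable g^`(k) x 1.
Proof.
move=> Cf gf.
have dG h fk : C fk -> (forall x, 0 < x < delta -> h x = fk (T x)) ->
    exists2 f', C f' & forall x, 0 < x < delta -> is_derive x (1 : R) h (f' (T x)).
  move=> Cfk hf; have [f' Cf' df'] := closed_derive Cfk.
  exists f' => // z zd; apply: near_eq_is_derive (df' z zd).
  by near=> r; rewrite /= hf //; near: r; exact: near_itv.
elim=> [|k [fk Cfk Hk]].
  have [f' _ df'] := dG g f Cf gf.
  by exists f => // x xd; split; [exact: gf|have [] := df' x xd].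
have hk x : 0 < x < delta -> g^`(k) x = fk (T x) by move=> xd; have [] := Hk x xd.
have [f' Cf' df'] := dG _ _ Cfk hk.
have hS x : 0 < x < delta -> g^`(k.+1) x = f' (T x).
  by move=> xd; rewrite derive1nS derive1E; have [_ ->] := df' x xd.
exists f' => // x xd; split; first exact: hS.
have [f'' _ df''] := dG _ _ Cf' hS.
by have [] := df'' x xd.
Unshelve. all: by end_near. Qed.

Lemma class_smooth_on g f : C f -> (forall x, 0 < x < delta -> g x = f (T x)) ->
  smooth_on 0 delta g.
Proof.
by move=> Cf gf k x xd; have [fk _ /(_ x xd)[]] := derive1n_class Cf gf k.
Qed.

(** All derivatives of g are again members of C composed with T, so it suffices
    to know the limits of such compositions. *)
Lemma class_smooth_left_limit g f : C f -> (forall x, 0 < x < delta -> g x = f (T x)) ->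
  smooth_left_limit g delta.
Proof.
move=> Cf gf k; have [fk Cfk Hk] := derive1n_class Cf gf k.
have /cvg_ex[/= l Hl] := left_limit Cfk; apply/cvg_ex; exists l => /=.
apply: cvg_trans Hl; apply: near_eq_cvg; near=> x.
have x0 : 0 < x by near: x; exact: nbhs_left_gt.
by have [|->//] := Hk x; apply/andP.
Unshelve. all: by end_near. Qed.

End IteratedDerivatives.

(** Polynomials in W, X, Y and in the inverses of W and Y.  The system makes
    this ring stable under d/dy, hence under d/dx = (1/W) d/dy. *)
Inductive solution_ring {R : realType} (W X Y : R -> R) : (R -> R) -> Prop :=
| SolCst c : solution_ring W X Y (fun=> c)
| SolW : solution_ring W X Y W
| SolX : solution_ring W X Y X
| SolY : solution_ring W X Y Y
| SolWinv : solution_ring W X Y (fun y => (W y)^-1)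
| SolYinv : solution_ring W X Y (fun y => (Y y)^-1)
| SolD f g : solution_ring W X Y f -> solution_ring W X Y g ->
    solution_ring W X Y (fun y => f y + g y)
| SolM f g : solution_ring W X Y f -> solution_ring W X Y g ->
    solution_ring W X Y (fun y => f y * g y).

Section SolutionRing.
Context {R : realType}.
Variables (s lam : R) (W X Y : R -> R).
Hypothesis W_gt0 : forall y, y <= 0 -> 0 < W y.
Hypothesis Y_gt0 : forall y, y <= 0 -> 0 < Y y.
Hypothesis dW : forall y, y <= 0 -> is_derive (y : R) (1 : R) W (rhsW lam (W y) (X y)).
Hypothesis dX : forall y, y <= 0 -> is_derive (y : R) (1 : R) X (rhsX s lam (W y) (X y) (Y y)).
Hypothesis dY : forall y, y <= 0 -> is_derive (y : R) (1 : R) Y (rhsY s lam (W y) (X y) (Y y)).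

Local Notation sol := (solution_ring W X Y).

Lemma solution_ring_derive f : sol f -> exists2 f', sol f' &
  forall y, y <= 0 -> is_derive (y : R) (1 : R) f (f' y).
Proof.
have sW := SolW W X Y; have sX := SolX W X Y; have sY := SolY W X Y.
have sWV := SolWinv W X Y; have sYV := SolYinv W X Y; have sc := SolCst W X Y.
have lWW : sol (fun y => - lam * (W y * W y)).
  by apply: (SolM (sc _)); exact: SolM.
have sW' : sol (fun y => X y * X y + - lam * (W y * W y)).
  by apply: SolD lWW; exact: SolM.
have sY' : sol (fun y => X y * X y + - lam * (W y * W y) + - s^-1 * X y).
  by apply: SolD => //; exact: (SolM (sc _)).
elim=> {f} [c||||||f g _ [f' sf' df'] _ [g' sg' dg']|f g sf [f' sf' df'] sg [g' sg' dg']].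
- by exists (fun=> 0) => // y _; exact: is_derive_cst.
- exists (fun y => W y * (X y * X y + - lam * (W y * W y))); first exact: SolM.
  by move=> y y0; have := dW y0; congr is_derive; rewrite /rhsW; ring.
- exists (fun y => X y * (X y * X y + - lam * (W y * W y)) + - 1 * X y + s^-1 * (Y y * Y y)
    + lam * s * (W y * W y)).
    apply: SolD; first apply: SolD; first apply: SolD.
    + exact: SolM.
    + exact: (SolM (sc _)).
    + by apply: (SolM (sc _)); exact: SolM.
    + by apply: (SolM (sc _)); exact: SolM.
  by move=> y y0; have := dX y0; congr is_derive; rewrite /rhsX; ring.
- exists (fun y => Y y * (X y * X y + - lam * (W y * W y) + - s^-1 * X y)); first exact: SolM.
  by move=> y y0; have := dY y0; congr is_derive; rewrite /rhsY; ring.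
- exists (fun y => - 1 * (X y * X y + - lam * (W y * W y)) * (W y)^-1).
    by apply: SolM => //; exact: (SolM (sc _)).
  move=> y y0; have Wy : W y != 0 by rewrite gt_eqF // W_gt0.
  by have := is_derive_inv Wy (dW y0); congr is_derive; rewrite /rhsW; field.
- exists (fun y => - 1 * (X y * X y + - lam * (W y * W y) + - s^-1 * X y) * (Y y)^-1).
    by apply: SolM => //; exact: (SolM (sc _)).
  move=> y y0; have Yy : Y y != 0 by rewrite gt_eqF // Y_gt0.
  have := is_derive_inv Yy (dY y0); congr is_derive; rewrite /rhsY.
  by move: (s^-1) => r; field.
- exists (fun y => f' y + g' y); first exact: SolD.
  by move=> y y0; apply: is_derive_add; [exact: df'|exact: dg'].
- exists (fun y => f' y * g y + f y * g' y); first by apply: SolD; exact: SolM.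
  by move=> y y0; apply: is_derive_mul; [exact: df'|exact: dg'].
Qed.

End SolutionRing.

(** * The soliton metric and its asymptotic profile *)

Section Profile.
Context {R : realType}.
Variables (n : nat) (lam : R) (W X Y : R -> R).
Hypothesis n2 : (2 <= n)%N.
Let s : R := Num.sqrt n%:R.
Hypothesis s1 : 1 < s.
Let c : R := (1 - s^-1) / 2.
Hypotheses (cW : continuous W) (cX : continuous X).
Hypothesis W00 : 0 < W 0.
Hypothesis Y00 : 0 < Y 0.
Hypothesis dW : forall y, y <= 0 -> is_derive (y : R) (1 : R) W (rhsW lam (W y) (X y)).
Hypothesis dX : forall y, y <= 0 -> is_derive (y : R) (1 : R) X (rhsX s lam (W y) (X y) (Y y)).
Hypothesis dY : forall y, y <= 0 -> is_derive (y : R) (1 : R) Y (rhsY s lam (W y) (X y) (Y y)).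
Hypothesis decay : forall y, y <= 0 ->
  [/\ `|W y| <= expR (c * y), `|X y - 1| <= expR (c * y) & `|Y y| <= expR (c * y)].

Let s_gt0 : 0 < s. Proof. exact: lt_trans ltr01 s1. Qed.
Let s_sqr : s ^+ 2 = n%:R. Proof. by rewrite sqr_sqrtr. Qed.
Let c_gt0 : 0 < c.
Proof. by rewrite divr_gt0 // subr_gt0 invf_lt1. Qed.

Let cWg : continuous (fun y => X y ^+ 2 - lam * W y ^+ 2).
Proof.
move=> y; apply: cvgB; first by apply: cvgM; exact: cX.
by apply: cvgMr; apply: cvgM; exact: cW.
Qed.

Let cYg : continuous (fun y => X y ^+ 2 - X y / s - lam * W y ^+ 2).
Proof.
move=> y; apply: cvgB; last by apply: cvgMr; apply: cvgM; exact: cW.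
by apply: cvgB; [apply: cvgM; exact: cX|apply: cvgMl; exact: cX].
Qed.

Let W_gt0 y : y <= 0 -> 0 < W y.
Proof.
have [P [_ _ WE]] := integrating_factor cWg dW.
by move=> y0; rewrite WE // mulr_gt0 // expR_gt0.
Qed.

Let Y_gt0 y : y <= 0 -> 0 < Y y.
Proof.
have [P [_ _ YE]] := integrating_factor cYg dY.
by move=> y0; rewrite YE // mulr_gt0 // expR_gt0.
Qed.

(** The logarithmic derivative of W tends to 1 exponentially fast. *)
Let rate_W y : y <= 0 -> `|X y ^+ 2 - lam * W y ^+ 2 - 1| <= (3 + `|lam|) * expR (c * y).
Proof.
move=> y0; have [hW hX _] := decay y0; set E := expR (c * y) in hW hX *.
have E0 : 0 <= E by exact: expR_ge0.
have E1 : E <= 1 by rewrite expR_le1 mulr_ge0_le0 // ltW.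
have -> : X y ^+ 2 - lam * W y ^+ 2 - 1 = (X y - 1) * (X y + 1) - lam * (W y * W y) by ring.
apply: le_trans (ler_normB _ _) _; rewrite !normrM mulrDl; apply: lerD.
  rewrite mulrC; apply: ler_pM => //.
  have -> : X y + 1 = (X y - 1) + 2 by ring.
  apply: le_trans (ler_normD _ _) _; by rewrite [X in _ + X]ger0_norm //; lra.
apply: ler_wpM2l => //; rewrite -[E]mulr1; apply: ler_pM => //.
exact: le_trans hW E1.
Qed.

Lemma soliton_primitive : exists S : R -> R,
  (forall y, is_derive y (1 : R) S (W y)) /\ S y @[y --> -oo] --> (0 : R).
Proof.
have [F [_ dF]] := primitive_exists cW.
have [l Hl] := exp_derive_limit (B := 1) c_gt0 (fun t _ => dF t)
  (fun t t0 => let: And3 h _ _ := decay t0 in eq_ind_r (fun u => `|W t| <= u) h (mul1r _)).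
exists (fun y => F y - l); split.
  by move=> y; rewrite -[W y]subr0; apply: is_derive_sub.
by apply: (exp_dominated_cvgNy c_gt0) => t t0; rewrite subr0; exact: Hl.
Qed.

Section WithPrimitive.
Variable S : R -> R.
Hypothesis dS : forall y, is_derive y (1 : R) S (W y).
Hypothesis S0 : S y @[y --> -oo] --> (0 : R).

Let S_gt0 := primitive_gt0 W_gt0 dS S0.

(** W and S both vanish at minus infinity and W' - S' is o(S'), so that W - S is
    o(S). *)
Lemma W_equiv_S : W y / S y @[y --> -oo] --> (1 : R).
Proof.
apply: (exp_dominated_cvgNy c_gt0 (B := 3 + `|lam|)) => y y0.
have Sy := S_gt0 y0; set K := (3 + `|lam|) * expR (c * y).
have K0 : 0 <= K by rewrite mulr_ge0 ?expR_ge0 // addr_ge0.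
suff H : `|W y - S y| <= K * S y.
  have -> : W y / S y - 1 = (W y - S y) / S y by field; rewrite gt_eqF.
  by rewrite normrM normfV (gtr0_norm Sy) ler_pdivrMr.
have step (t : R) : t <= y -> `|(W y - S y) - (W t - S t)| <= K * S y - K * S t.
  move=> ty; pose f' r := rhsW lam (W r) (X r) - W r.
  apply: (derive_dominated ty (f := W \- S) (f' := f') (g := fun r => K * S r)
    (g' := fun r => K * W r)).
  - move=> r /andP[_ ry]; apply: is_derive_sub => //.
    by apply: dW; exact: le_trans ry y0.
  - move=> r /andP[_ ry]; have r0 := le_trans ry y0.
    have -> : f' r = (X r ^+ 2 - lam * W r ^+ 2 - 1) * W r by rewrite /f' /rhsW; ring.
    rewrite normrM (gtr0_norm (W_gt0 r0)) ler_wpM2r ?(ltW (W_gt0 r0)) //.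
    apply: le_trans (rate_W r0) _; rewrite ler_wpM2l ?addr_ge0 // ler_expR.
    by rewrite ler_wpM2l // ltW.
(* The contribution of the lower end point disappears in the limit. *)
have lim : `|(W y - S y) - (W t - S t)| @[t --> -oo] --> `|W y - S y|.
  have W0 : W t @[t --> -oo] --> (0 : R).
    apply: (exp_dominated_cvgNy c_gt0 (B := 1)) => t t0; rewrite subr0 mul1r.
    by have [] := decay t0.
  have -> : `|W y - S y| = `|(W y - S y) - (0 - 0)| by rewrite subrr subr0.
  by apply: cvg_norm; apply: cvgB; [exact: cvg_cst|exact: cvgB].
apply: (cvgr_to_le lim).
have t0 : \forall t \near -oo, t <= y by exact: nbhs_ninfty_le (num_real _).
near=> t; have ty : t <= y by near: t.
apply: le_trans (step t ty) _; rewrite lerBlDr lerDl mulr_ge0 //.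
by apply/ltW/S_gt0; exact: le_trans ty y0.
Unshelve. all: by end_near. Qed.

(** Write W / Y as a constant times exp(P - Q), with P and Q the primitives of
    the logarithmic derivatives of W and Y.  Then P - Q - P / sqrt n has
    derivative (X - X^2 + lam W^2) / sqrt n, which decays exponentially, so it
    converges, and W may be replaced by S. *)
Lemma WY_equiv_power : exists2 a, 0 < a &
  (W y / Y y) / (a * S y `^ s^-1) @[y --> -oo] --> (1 : R).
Proof.
have [P [P0 dP WE]] := integrating_factor cWg dW.
have [Q [Q0 dQ YE]] := integrating_factor cYg dY.
set r := s^-1.
pose D y := P y - Q y - r * P y.
pose D' y := r * (X y - (X y ^+ 2 - lam * W y ^+ 2)).
have dD (t : R) : t <= 0 -> is_derive t (1 : R) D (D' t).
  move=> _; have := is_derive_sub (is_derive_sub (dP t) (dQ t))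
    (is_derive_mul (is_derive_cst r t (1 : R)) (dP t)).
  by congr is_derive; rewrite /D' /cst /= -/r; ring.
have r0 : 0 < r by rewrite invr_gt0.
have D'b t : t <= 0 -> `|D' t| <= r * (4 + `|lam|) * expR (c * t).
  move=> t0; rewrite normrM (gtr0_norm r0) -mulrA ler_pM2l //.
  have -> : X t - (X t ^+ 2 - lam * W t ^+ 2) = (X t - 1) - (X t ^+ 2 - lam * W t ^+ 2 - 1) by ring.
  apply: le_trans (ler_normB _ _) _.
  have [_ hX _] := decay t0; have hR := rate_W t0.
  have -> : (4 + `|lam|) * expR (c * t) = expR (c * t) + (3 + `|lam|) * expR (c * t) by ring.
  exact: lerD.
have [l Hl] := exp_derive_limit c_gt0 dD D'b.
have Dl : D y @[y --> -oo] --> l by exact: exp_dominated_cvgNy c_gt0 Hl.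
(* The limit of (W / Y) / W^r, with r = 1 / sqrt n. *)
exists (W 0 / Y 0 * expR (l - r * ln (W 0))).
  by rewrite mulr_gt0 ?expR_gt0 // divr_gt0.
have E : expR (D y - l + r * ln (W y / S y)) @[y --> -oo] --> (1 : R).
  have -> : (1 : R) = expR (l - l + r * ln 1) by rewrite ln1 mulr0 subrr addr0 expR0.
  apply: (@continuous_cvg _ _ _ _ _ (fun y => D y - l + r * ln (W y / S y)) expR).
    exact: continuous_expR.
  apply: cvgD; first by apply: cvgB => //; exact: cvg_cst.
  apply: cvgMr; apply: (@continuous_cvg _ _ _ _ _ (fun y => W y / S y) (@ln R)).
    exact: continuous_ln.
  exact: W_equiv_S.
apply: cvg_trans E; apply: near_eq_cvg.
have t0 : \forall t \near -oo, t <= (0 : R) by exact: nbhs_ninfty_le (num_real _).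
near=> y; have y0 : y <= 0 by near: y.
have Sy := S_gt0 y0; have Wy := W_gt0 y0.
rewrite /powR (gt_eqF Sy) ln_div ?posrE //.
have -> : ln (W y) = ln (W 0) + P y by rewrite WE // lnM ?posrE ?expR_gt0 // expRK.
rewrite [in RHS]WE // YE //.
have -> : D y - l + r * (ln (W 0) + P y - ln (S y)) =
  P y - Q y - (l - r * ln (W 0)) - r * ln (S y) by rewrite /D; ring.
rewrite !(expRB (_ - _ - _)) (expRB (_ - _) (l - _)) (expRB (P y)).
have := expR_gt0 (Q y); have := expR_gt0 (l - r * ln (W 0)); have := expR_gt0 (r * ln (S y)).
move: (expR (P y)) (expR (Q y)) (expR (l - _)) (expR (r * ln (S y))) => p q u v v0 u0 q0.
by field; rewrite !gt_eqF.
Unshelve. all: by end_near. Qed.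

Lemma omega_equiv : ((s * X y - 1) / W y) / ((s - 1) / S y) @[y --> -oo] --> (1 : R).
Proof.
have s10 : s - 1 != 0 by rewrite gt_eqF // subr_gt0.
have X1 : X y @[y --> -oo] --> (1 : R).
  apply: (exp_dominated_cvgNy c_gt0 (B := 1)) => t t0; rewrite mul1r.
  by have [] := decay t0.
have E : (s * X y - 1) / (s - 1) * (W y / S y)^-1 @[y --> -oo] --> (1 : R).
  have E1 : (s * 1 - 1) / (s - 1) * 1^-1 = 1 by rewrite mulr1 mulfV // mul1r invr1.
  rewrite -[X in _ --> X]E1.
  apply: cvgM; last by apply: cvgV; [exact: oner_neq0|exact: W_equiv_S].
  apply: cvgMl; apply: cvgB; last exact: cvg_cst.
  by apply: cvgMr.
apply: cvg_trans E; apply: near_eq_cvg.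
have t0 : \forall t \near -oo, t <= (0 : R) by exact: nbhs_ninfty_le (num_real _).
near=> y; have y0 : y <= 0 by near: y.
have Sy := S_gt0 y0; have Wy := W_gt0 y0.
by field; rewrite s10 !gt_eqF.
Unshelve. all: by end_near. Qed.

End WithPrimitive.

(** psi, omega and phi are defined as functions of y and composed with the
    inverse T of the arclength S; phi is the primitive of omega dx =
    (sqrt n X - 1) dy. *)
Lemma soliton_metric : exists (delta : R) (psi omega phi : R -> R),
  [/\ 0 < delta,
      [/\ smooth_on 0 delta psi, smooth_on 0 delta phi &
          forall x : R, 0 < x < delta -> 0 < psi x /\ phi^`() x = omega x],
      corresponds n delta W X Y psi omega,
      warped_gradient_soliton n lam delta psi phi &
      [/\ exists2 a : R, 0 < a &
            equivalent_at_0plus psi (fun x => a * x `^ (Num.sqrt n%:R)^-1),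
          equivalent_at_0plus omega (fun x => (Num.sqrt n%:R - 1) / x),
          smooth_left_limit psi delta &
          smooth_left_limit omega delta]].
Proof.
have [S [dS S0]] := soliton_primitive.
have [T [TS ST dT TNy T0]] := primitive_inverse W_gt0 dS S0.
have S_gt0 := primitive_gt0 W_gt0 dS S0.
have AE := arclengthE cW W_gt0 dS S0.
pose delta := S 0.
have delta_gt0 : 0 < delta by exact: S_gt0.
have n1 : 1 < n%:R :> R by rewrite ltr1n.
pose K : R := Num.sqrt (n%:R * (n%:R - 1)).
have K2 : K ^+ 2 = n%:R * (n%:R - 1).
  by rewrite sqr_sqrtr // mulr_ge0 // subr_ge0 ltW.
have K_gt0 : 0 < K by rewrite sqrtr_gt0 mulr_gt0 ?subr_gt0 // (lt_trans _ n1).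
have s_neq0 : s != 0 by rewrite gt_eqF.
pose fpsi y := K * (W y * (Y y)^-1).
pose fom y := (s * X y + -1) * (W y)^-1.
(* As functions of y: h = psi' / psi, then dh/dx and domega/dx. *)
pose fh y := X y / (s * W y).
pose fh' y := (- X y + Y y ^+ 2 / s + lam * s * W y ^+ 2) / (s * W y ^+ 2).
pose fom' y := (- s * X y + Y y ^+ 2 + lam * s ^+ 2 * W y ^+ 2 + X y ^+ 2 - lam * W y ^+ 2)
  / W y ^+ 2.
have [Phi [_ dPhi]] : exists F, F 0 = 0 /\ forall x, is_derive x (1 : R) F (s * X x - 1).
  apply: primitive_exists => y; apply: cvgB; last exact: cvg_cst.
  by apply: cvgMr; exact: cX.
have Tdom (x : R) : 0 < x < delta -> [/\ T x <= 0, W (T x) != 0 & Y (T x) != 0].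
  by move=> /ST[T0x _]; rewrite !gt_eqF ?W_gt0 ?Y_gt0 ?ltW.
have dcomp (f : R -> R) (l x : R) : 0 < x < delta -> is_derive (T x) (1 : R) f l ->
    is_derive x (1 : R) (f \o T) (l / W (T x)).
  by move=> xd df; apply: is_derive_comp df (dT x xd).
have dsW (y : R) : y <= 0 -> is_derive y (1 : R) (fun z => s * W z) (s * rhsW lam (W y) (X y)).
  move=> y0; have := is_derive_mul (is_derive_cst s y (1 : R)) (dW y0).
  by congr is_derive; rewrite /cst /=; ring.
have dpsi (x : R) : 0 < x < delta -> is_derive x (1 : R) (fpsi \o T) ((fpsi \o T) x * (fh \o T) x).
  move=> xd; have [Tx0 Wx Yx] := Tdom x xd.
  have := dcomp _ _ _ xd (is_derive_mul (is_derive_cst K (T x) (1 : R))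
    (is_derive_mul (dW Tx0) (is_derive_inv Yx (dY Tx0)))).
  congr is_derive; rewrite /fpsi /fh /rhsW /rhsY /cst /=.
  by field; rewrite s_neq0 Wx Yx.
have dh (x : R) : 0 < x < delta -> is_derive x (1 : R) (fh \o T) ((fh' \o T) x).
  move=> xd; have [Tx0 Wx Yx] := Tdom x xd.
  have sWx : s * W (T x) != 0 by rewrite mulf_neq0.
  have := dcomp _ _ _ xd (is_derive_mul (dX Tx0)
    (is_derive_inv (f := fun z => s * W z) sWx (dsW _ Tx0))).
  congr is_derive; rewrite /fh' /rhsW /rhsX /=.
  by field; rewrite s_neq0 Wx.
have dom (x : R) : 0 < x < delta -> is_derive x (1 : R) (fom \o T) ((fom' \o T) x).
  move=> xd; have [Tx0 Wx Yx] := Tdom x xd.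
  have := dcomp _ _ _ xd (is_derive_mul (is_derive_add (is_derive_mul
    (is_derive_cst s (T x) (1 : R)) (dX Tx0)) (is_derive_cst (-1 : R) (T x) (1 : R)))
    (is_derive_inv Wx (dW Tx0))).
  congr is_derive; rewrite /fom' /rhsW /rhsX /cst /=.
  by field; rewrite s_neq0 Wx.
have dphi (x : R) : 0 < x < delta -> is_derive x (1 : R) (Phi \o T) ((fom \o T) x).
  by move=> xd; exact: dcomp xd (dPhi _).
have psi_gt0 (x : R) : 0 < x < delta -> 0 < (fpsi \o T) x.
  move=> xd; have [Tx0 _ _] := Tdom x xd.
  by rewrite mulr_gt0 // divr_gt0 ?W_gt0 ?Y_gt0.
pose C := solution_ring W X Y.
have C_derive (f : R -> R) : C f -> exists2 f', C f' &
    forall x, 0 < x < delta -> is_derive x (1 : R) (f \o T) (f' (T x)).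
  move=> Cf; have [f' Cf' df'] := solution_ring_derive W_gt0 Y_gt0 dW dX dY Cf.
  exists (fun y => f' y * (W y)^-1); first exact: SolM Cf' (SolWinv _ _ _).
  by move=> x xd; have [Tx0 _ _] := Tdom x xd; apply: dcomp => //; exact: df'.
have C_limit (f : R -> R) : C f -> cvg (f (T x) @[x --> delta^'-]).
  move=> Cf; have [f' Cf' df'] := solution_ring_derive W_gt0 Y_gt0 dW dX dY Cf.
  apply/cvg_ex; exists (f 0) => /=.
  by apply: cvg_comp T0 _; exact: is_derive_continuous (df' 0 (lexx _)).
have Cpsi : C fpsi by apply: (SolM (SolCst _ _ _ _)); exact: SolM (SolW _ _ _) (SolYinv _ _ _).
have Com : C fom.
  apply: SolM (SolWinv _ _ _); apply: SolD (SolCst _ _ _ _).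
  exact: SolM (SolCst _ _ _ _) (SolX _ _ _).
have phi'E (x : R) : 0 < x < delta -> (Phi \o T)^`() x = fom (T x).
  by move=> xd; rewrite derive1E; have [_ ->] := dphi x xd.
exists delta, (fpsi \o T), (fom \o T), (Phi \o T); split => //.
- split.
  + exact: (class_smooth_on C_derive Cpsi).
  + case=> [|k] x xd; first by have [] := dphi x xd.
    (* From the second derivative on, those of phi are derivatives of omega. *)
    rewrite derive1Sn; exact: (class_smooth_on C_derive Com phi'E).
  + by move=> x xd; split; [exact: psi_gt0|exact: phi'E].
- have Sdom y : y < 0 -> 0 < S y < delta.
    by move=> y0; rewrite S_gt0 ?(ltW y0) //= (primitive_increasing W_gt0 dS).
  split.
  + exact: (integrable_Ny cW W_gt0 dS S0).
  + exact: (arclength_cvg cW W_gt0 dS S0).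
  + exact: AE.
  + exact: (arclength_image cW W_gt0 dS S0).
  + by move=> y y0 x; rewrite /x AE ?(ltW y0) //= TS.
  + move=> y y0 x; have xE : x = S y by rewrite /x AE // ltW.
    have := dpsi (S y) (Sdom y y0); rewrite xE derive1E => -[_ ->].
    rewrite /= TS //; have Wy := W_gt0 (ltW y0); have Yy := Y_gt0 (ltW y0).
    have Wy0 : W y != 0 by rewrite gt_eqF.
    have Yy0 : Y y != 0 by rewrite gt_eqF.
    have K0 : K != 0 by rewrite gt_eqF.
    have hE : fpsi y * fh y / fpsi y = fh y.
      by rewrite mulrAC divff ?mul1r // /fpsi !mulf_neq0 // invr_neq0.
    rewrite hE -/s -/K; split.
    * rewrite /fom /fh -s_sqr.
      have -> : - ((s * X y + -1) / W y) + s ^+ 2 * (X y / (s * W y)) = (W y)^-1.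
        by field; rewrite s_neq0 Wy0.
      by rewrite invrK.
    * by rewrite /fh; field; rewrite s_neq0 Wy0.
    * by rewrite /fpsi; field; rewrite K0 Yy0 Wy0.
- apply: (warped_soliton psi_gt0 dpsi dh dphi dom) => x xd /=;
    have [_ Wx Yx] := Tdom x xd; rewrite /fom' /fh' /fh /fom /fpsi.
  + by rewrite -s_sqr; field; rewrite s_neq0 Wx.
  + rewrite exprMn K2 -s_sqr.
    by field; rewrite s_neq0 Wx Yx.
- split.
  + have [a a0 Ha] := WY_equiv_power dS S0.
    exists (K * a); first exact: mulr_gt0.
    rewrite /equivalent_at_0plus.
    have : (fun y => (W y / Y y) / (a * S y `^ s^-1)) (T x) @[x --> (0 : R)^'+] --> (1 : R).
      exact: cvg_comp TNy Ha.
    apply: cvg_trans; apply: near_eq_cvg; near=> x.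
    have xd : 0 < x < delta by apply/andP; split; [|near: x; exact: nbhs_right_lt].
    have [_ STx] := ST x xd; rewrite /= /fpsi STx.
    have xp : x `^ s^-1 != 0 by rewrite gt_eqF // powR_gt0 //; case/andP: xd.
    have K0 : K != 0 by rewrite gt_eqF.
    have a00 : a != 0 by rewrite gt_eqF.
    have [_ Wx Yx] := Tdom x xd.
    by field; rewrite K0 a00 xp Yx.
  + rewrite /equivalent_at_0plus.
    have : (fun y => ((s * X y - 1) / W y) / ((s - 1) / S y)) (T x) @[x --> (0 : R)^'+] --> (1 : R).
      exact: cvg_comp TNy (omega_equiv dS S0).
    apply: cvg_trans; apply: near_eq_cvg; near=> x.
    have xd : 0 < x < delta by apply/andP; split; [|near: x; exact: nbhs_right_lt].
    by have [_ STx] := ST x xd; rewrite /= /fom STx.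
  + exact: (class_smooth_left_limit delta_gt0 C_derive C_limit Cpsi).
  + exact: (class_smooth_left_limit delta_gt0 C_derive C_limit Com).
Unshelve. all: by end_near. Qed.

End Profile.

Theorem proposition2p1 (R : realType) (n : nat) (lambda : R) (hn : (2 <= n)%N) :
  exists2 eps : R, 0 < eps &
  forall W0 X0 Y0 : R, 0 < W0 -> 0 < Y0 ->
  `|W0| < eps -> `|X0 - 1| < eps -> `|Y0| < eps ->
  exists W X Y : R -> R,
  [/\ soliton_system n lambda `]-oo, 0] W X Y,
      [/\ W 0 = W0, X 0 = X0 & Y 0 = Y0],
      (forall (a : R) (W1 X1 Y1 : R -> R), a < 0 ->
        soliton_system n lambda `[a, 0] W1 X1 Y1 ->
        W1 0 = W0 -> X1 0 = X0 -> Y1 0 = Y0 ->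
        forall y : R, a <= y <= 0 ->
          [/\ W1 y = W y, X1 y = X y & Y1 y = Y y]) &
      exists (delta : R) (psi omega phi : R -> R),
      [/\ 0 < delta,
          [/\ smooth_on 0 delta psi, smooth_on 0 delta phi &
              forall x : R, 0 < x < delta -> 0 < psi x /\ phi^`() x = omega x],
          corresponds n delta W X Y psi omega,
          warped_gradient_soliton n lambda delta psi phi &
          [/\ exists2 a : R, 0 < a &
                equivalent_at_0plus psi
                  (fun x => a * x `^ (Num.sqrt n%:R)^-1),
              equivalent_at_0plus omega
                (fun x => (Num.sqrt n%:R - 1) / x),
              smooth_left_limit psi delta &
              smooth_left_limit omega delta]]].
Proof.
have s1 : 1 < Num.sqrt (n%:R : R) by rewrite -[ltLHS]sqrtr1 ltr_sqrt ?ltr0n ?ltr1n // ltnW.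
have [rho rho0 flow] := soliton_flow lambda s1.
exists (rho / 2); first by rewrite divr_gt0.
move=> W0 X0 Y0 W0_gt0 Y0_gt0 hW hX hY.
have [W [X [Y [[EW EX EY] [cW cX] ode decay]]]] := flow W0 X0 Y0 hW hX hY.
have sys (J : set R) : (forall y, J y -> y <= 0) -> soliton_system n lambda J W X Y.
  move=> J0 y Jy; have [dW dX dY] := ode y (J0 y Jy).
  by split; [exact: is_derive_within dW|exact: is_derive_within dX|exact: is_derive_within dY].
exists W, X, Y; split.
- by apply: sys => y; rewrite /= in_itv.
- by split.
- move=> a W1 X1 Y1 a0 sol1 E1 E2 E3; apply: (@soliton_unique R n lambda a) => //; last 3 first.
  + by rewrite E1.
  + by rewrite E2.
  + by rewrite E3.
  by apply: sys => y; rewrite /= in_itv/= => /andP[].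
- apply: (soliton_metric hn s1 cW cX).
  + by rewrite EW.
  + by rewrite EY.
  + by move=> y y0; have [] := ode y y0.
  + by move=> y y0; have [] := ode y y0.
  + by move=> y y0; have [] := ode y y0.
  + by move=> y y0; exact: decay.
Qed.
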